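(* Let $K\neq0$ and let $A,P,B,Q$ be points of an $\Re_K$ domain $(\mathcal M,\rho)$ with $A\neq P$, $B\neq Q$, and, if $K>0$, $\operatorname{diam}\{A,P,B,Q\}\le\pi/(2\sqrt K)$. Then $|\operatorname{cosq}_K(\overrightarrow{AP},\overrightarrow{BQ})|\le1$.
   Context: Let $\kappa=\sqrt{|K|}$. For $A\neq P$, $B\neq Q$ put $x=\rho(A,P)$, $y=\rho(B,Q)$, $a=\rho(A,B)$, $b=\rho(P,Q)$, $d=\rho(P,B)$, $f=\rho(A,Q)$; for $K>0$ $$\operatorname{cosq}_K(\overrightarrow{AP},\overrightarrow{BQ})=\frac{\cos\kappa b+\cos\kappa x\cos\kappa y}{\sin\kappa x\sin\kappa y}-\frac{(\cos\kappa x+\cos\kappa d)(\cos\kappa y+\cos\kappa f)}{(1+\cos\kappa a)\sin\kappa x\sin\kappa y},$$ and for $K<0$ $$\operatorname{cosq}_K(\overrightarrow{AP},\overrightarrow{BQ})=\frac{(\cosh\kappa x+\cosh\kappa d)(\cosh\kappa y+\cosh\kappa f)}{(1+\cosh\kappa a)\sinh\kappa x\sinh\kappa y}-\frac{\cosh\kappa b+\cosh\kappa x\cosh\kappa y}{\sinh\kappa x\sinh\kappa y}.$$ $\Re_K$ domain: a metric space in which any two points are joined by a shortest (curve of length equal to their distance), in which (if $K>0$) every geodesic triangle has perimeter $<2\pi/\sqrt K$, and in which every geodesic triangle $ABC$ has sum of upper angles between its sides at its three vertices at most $\angle_KBAC+\angle_KABC+\angle_KACB$, where $\angle_K$ denotes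 the angle of the comparison triangle with the same side lengths in the model plane $\mathbb S_K$ (open hemisphere of radius $1/\sqrt K$ for $K>0$, hyperbolic plane of curvature $K$ for $K<0$), and the upper angle between shortests $\mathcal L,\mathcal N$ from $O$ is $\limsup\angle_0XOY$ as $X\to O$ in $\mathcal L\setminus\{O\}$, $Y\to O$ in $\mathcal N\setminus\{O\}$ ($\angle_0$ = Euclidean comparison angle). *)

(* Defs.v *)
From Stdlib Require Import Reals Lra.
Open Scope R_scope.

Definition is_metric {M : Type} (rho : M -> M -> R) : Prop :=
  (forall x y, 0 <= rho x y) /\
  (forall x y, rho x y = 0 <-> x = y) /\
  (forall x y, rho x y = rho y x) /\
  (forall x y z, rho x z <= rho x y + rho y z).

Definition curve_on {M : Type} (rho : M -> M -> R) (g : R -> M) (a b : R) : Prop :=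
  a <= b /\
  forall t, a <= t <= b -> forall eps, 0 < eps ->
    exists delta, 0 < delta /\
      forall s, a <= s <= b -> Rabs (s - t) < delta -> rho (g s) (g t) < eps.

Definition is_partition (a b : R) (p : nat -> R) (n : nat) : Prop :=
  p 0%nat = a /\ p n = b /\ forall i, (i < n)%nat -> p i <= p (S i).

Fixpoint poly_sum {M : Type} (rho : M -> M -> R) (g : R -> M) (p : nat -> R) (n : nat) : R :=
  match n with
  | O => 0
  | S k => poly_sum rho g p k + rho (g (p k)) (g (p (S k)))
  end.

Definition curve_length {M : Type} (rho : M -> M -> R) (g : R -> M) (a b L : R) : Prop :=
  is_lub (fun s => exists p n, is_partition a b p n /\ s = poly_sum rho g p n) L.

Definition curve_image {M : Type} (g : R -> M) (a b : R) : M -> Prop :=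
  fun x => exists t, a <= t <= b /\ x = g t.

Definition shortest {M : Type} (rho : M -> M -> R) (X Y : M) (S : M -> Prop) : Prop :=
  exists g a b, curve_on rho g a b /\ g a = X /\ g b = Y /\
    curve_length rho g a b (rho X Y) /\
    (forall x, S x <-> curve_image g a b x).

(** Euclidean comparison angle  angle_0 X O Y  (law of cosines). *)
Definition angle0 {M : Type} (rho : M -> M -> R) (X O Y : M) : R :=
  acos ((rho O X ^ 2 + rho O Y ^ 2 - rho X Y ^ 2) / (2 * rho O X * rho O Y)).

Definition is_upper_angle {M : Type} (rho : M -> M -> R) (O : M) (S1 S2 : M -> Prop)
    (theta : R) : Prop :=
  forall eps, 0 < eps ->
    (exists delta, 0 < delta /\
       forall X Y, S1 X -> X <> O -> rho O X < delta ->
                   S2 Y -> Y <> O -> rho O Y < delta ->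
                   angle0 rho X O Y < theta + eps) /\
    (forall delta, 0 < delta ->
       exists X Y, S1 X /\ X <> O /\ rho O X < delta /\
                   S2 Y /\ Y <> O /\ rho O Y < delta /\
                   theta - eps < angle0 rho X O Y).

Definition kappa (K : R) : R := sqrt (Rabs K).

(** Angle at the vertex with adjacent sides b, c and opposite side a of the
    comparison triangle in the model plane S_K (K <> 0). *)
Definition model_angle (K a b c : R) : R :=
  let k := kappa K in
  if Rlt_dec 0 K then
    acos ((cos (k * a) - cos (k * b) * cos (k * c)) / (sin (k * b) * sin (k * c)))
  else
    acos ((cosh (k * b) * cosh (k * c) - cosh (k * a)) / (sinh (k * b) * sinh (k * c))).

Definition angleK {M : Type} (rho : M -> M -> R) (K : R) (B A C : M) : R :=
  model_angle K (rho B C) (rho A B) (rho A C).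

Definition RK_domain (K : R) {M : Type} (rho : M -> M -> R) : Prop :=
  is_metric rho /\
  (forall X Y : M, exists S, shortest rho X Y S) /\
  (0 < K -> forall (A B C : M) (SAB SBC SCA : M -> Prop),
      shortest rho A B SAB -> shortest rho B C SBC -> shortest rho C A SCA ->
      rho A B + rho B C + rho C A < 2 * PI / sqrt K) /\
  (forall (A B C : M) (SAB SBC SCA : M -> Prop),
      A <> B -> B <> C -> C <> A ->
      shortest rho A B SAB -> shortest rho B C SBC -> shortest rho C A SCA ->
      forall tA tB tC,
        is_upper_angle rho A SAB SCA tA ->
        is_upper_angle rho B SAB SBC tB ->
        is_upper_angle rho C SCA SBC tC ->
        tA + tB + tC <= angleK rho K B A C + angleK rho K A B C + angleK rho K A C B).

Definition cosq {M : Type} (rho : M -> M -> R) (K : R) (A P B Q : M) : R :=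
  let k := kappa K in
  let x := rho A P in let y := rho B Q in let a := rho A B in
  let b := rho P Q in let d := rho P B in let f := rho A Q in
  if Rlt_dec 0 K then
    (cos (k * b) + cos (k * x) * cos (k * y)) / (sin (k * x) * sin (k * y))
    - (cos (k * x) + cos (k * d)) * (cos (k * y) + cos (k * f))
        / ((1 + cos (k * a)) * sin (k * x) * sin (k * y))
  else
    (cosh (k * x) + cosh (k * d)) * (cosh (k * y) + cosh (k * f))
        / ((1 + cosh (k * a)) * sinh (k * x) * sinh (k * y))
    - (cosh (k * b) + cosh (k * x) * cosh (k * y)) / (sinh (k * x) * sinh (k * y)).

Definition diam4_le {M : Type} (rho : M -> M -> R) (A P B Q : M) (D : R) : Prop :=
  forall X Y, (X = A \/ X = P \/ X = B \/ X = Q) -> (Y = A \/ Y = P \/ Y = B \/ Y = Q) ->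
    rho X Y <= D.

(* Main.v *)
(** The angle-sum condition implies the cosine form of the CAT(K) comparison, which implies a
    Cauchy-Schwarz inequality for four points, which implies the bound on [cosq].

    Angles: let [f1], [f2] be shortests from a common point with upper angle [alpha], and let
    [gamma(x, y)] be the comparison angle of [f1 x], [f2 y].  If [gamma(l1, l2) < alpha], then
    [gamma - c (ln x + ln y)] attains its minimum at some [(x, y)]; there the first variation of
    the distance keeps both base angles above their comparison angles up to [O(c)], whereas the
    angle-sum condition puts one of them below by [(alpha - gamma(l1, l2)) / 2].

    Four points: comparison for a point of a side says that in the formal vector space spanned
    by [P, Q, A, B], with products [ck (rho X Y)], the vectors [s P + t Q] and [al A + be B] with
    nonnegative weights satisfy Cauchy-Schwarz (reversed if [K < 0]), although the form need not
    have the signature of the model space.  Formally, [cosq] is the cosine between the direction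
    of [AP] transported along [AB] and the direction of [BQ]; suitable choices of weights turn
    the inequality into [cosq <= 1] and [-1 <= cosq]. *)

Require Import Defs.
From Stdlib Require Import Reals Lra Lia Nsatz Classical ClassicalEpsilon.
From Coquelicot Require Import Coquelicot.
Open Scope R_scope.

(** * Trigonometry of the model planes *)

(** The angle-sum condition bounds only the sum of three upper angles, so one of them can be
    isolated only where the other two are under control; the minimum provides such a place. The
    penalty is logarithmic because it tends to infinity at the common vertex, which keeps the
    minimizer away from it, while its derivative [c / x] is compensated by [sk K x], at most a
    constant times [x]. Hence the error is uniform in the unknown position of the minimizer, and [c]
    can be fixed beforehand.

    In the four-point part the weights must be nonnegative, since they describe points of sides; the
    natural coefficients may be negative, whence the case distinctions. For [K > 0] a product of
    norms is at most half the sum of their squares, which can make the inequality quadratic. For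
    [K < 0] the reversed inequality gives no such bound: the roots stay, and the weights are tuned
    to equality cases. *)

Definition sgK (K : R) : R := if Rlt_dec 0 K then 1 else -1.
Definition ck (K t : R) : R :=
  if Rlt_dec 0 K then cos (kappa K * t) else cosh (kappa K * t).
Definition sk (K t : R) : R :=
  if Rlt_dec 0 K then sin (kappa K * t) else sinh (kappa K * t).

(** The law of cosines solved for the cosine of the angle opposite [a]. The factor [sgK K] makes it
    one formula for both curvatures; in inequalities it reverses the estimates for hyperbolic
    cosines. *)
Definition cos_model (K a b c : R) : R :=
  sgK K * (ck K a - ck K b * ck K c) / (sk K b * sk K c).

Lemma kappa_pos (K : R) : K <> 0 -> 0 < kappa K.
Proof. intros HK. apply sqrt_lt_R0, Rabs_pos_lt, HK. Qed.

Lemma sgK_sq (K : R) : sgK K * sgK K = 1.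
Proof. unfold sgK; destruct (Rlt_dec 0 K); ring. Qed.

Lemma ck_sk_sq (K t : R) : ck K t * ck K t + sgK K * (sk K t * sk K t) = 1.
Proof.
  unfold ck, sk, sgK; destruct (Rlt_dec 0 K).
  - generalize (sin2_cos2 (kappa K * t)); unfold Rsqr; lra.
  - unfold cosh, sinh. set (u := kappa K * t).
    assert (E : exp u * exp (- u) = 1)
      by (rewrite <- exp_plus, Rplus_opp_r; apply exp_0).
    nra.
Qed.

Lemma ck_0 (K : R) : ck K 0 = 1.
Proof.
  unfold ck; destruct (Rlt_dec 0 K); rewrite Rmult_0_r; [apply cos_0 | apply cosh_0].
Qed.

Lemma sk_0 (K : R) : sk K 0 = 0.
Proof.
  unfold sk; destruct (Rlt_dec 0 K); rewrite Rmult_0_r; [apply sin_0 | apply sinh_0].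
Qed.

Lemma ck_plus (K a b : R) : ck K (a + b) = ck K a * ck K b - sgK K * (sk K a * sk K b).
Proof.
  unfold ck, sk, sgK; destruct (Rlt_dec 0 K); rewrite Rmult_plus_distr_l.
  - rewrite cos_plus; ring.
  - unfold cosh, sinh. rewrite Ropp_plus_distr, !exp_plus; field.
Qed.

Lemma sk_plus (K a b : R) : sk K (a + b) = sk K a * ck K b + ck K a * sk K b.
Proof.
  unfold ck, sk, sgK; destruct (Rlt_dec 0 K); rewrite Rmult_plus_distr_l.
  - rewrite sin_plus; ring.
  - unfold cosh, sinh. rewrite Ropp_plus_distr, !exp_plus; field.
Qed.

Lemma ck_opp (K t : R) : ck K (- t) = ck K t.
Proof.
  unfold ck; destruct (Rlt_dec 0 K); rewrite Ropp_mult_distr_r_reverse.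
  - apply cos_neg.
  - unfold cosh; rewrite Ropp_involutive; field.
Qed.

Lemma sk_opp (K t : R) : sk K (- t) = - sk K t.
Proof.
  unfold sk; destruct (Rlt_dec 0 K); rewrite Ropp_mult_distr_r_reverse.
  - apply sin_neg.
  - unfold sinh; rewrite Ropp_involutive; field.
Qed.

Lemma ck_minus (K a b : R) : ck K (a - b) = ck K a * ck K b + sgK K * (sk K a * sk K b).
Proof. unfold Rminus; rewrite ck_plus, ck_opp, sk_opp; ring. Qed.

Lemma is_derive_ck (K t : R) : is_derive (ck K) t (- sgK K * kappa K * sk K t).
Proof.
  unfold ck, sk, sgK; destruct (Rlt_dec 0 K).
  - auto_derive; [exact I | ring].
  - replace (- -1 * kappa K * sinh (kappa K * t)) with (kappa K * sinh (kappa K * t)) by ring.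
    apply (is_derive_comp cosh (fun u => kappa K * u)).
    + apply is_derive_Reals, derivable_pt_lim_cosh.
    + auto_derive; [exact I | ring].
Qed.

Lemma is_derive_sk (K t : R) : is_derive (sk K) t (kappa K * ck K t).
Proof.
  unfold ck, sk; destruct (Rlt_dec 0 K).
  - auto_derive; [exact I | ring].
  - apply (is_derive_comp sinh (fun u => kappa K * u)).
    + apply is_derive_Reals, derivable_pt_lim_sinh.
    + auto_derive; [exact I | ring].
Qed.

Lemma continuity_pt_ck (K t : R) : continuity_pt (ck K) t.
Proof.
  apply derivable_continuous_pt.
  exists (- sgK K * kappa K * sk K t). apply is_derive_Reals, is_derive_ck.
Qed.

Lemma continuity_pt_sk (K t : R) : continuity_pt (sk K) t.
Proof.
  apply derivable_continuous_pt.
  exists (kappa K * ck K t). apply is_derive_Reals, is_derive_sk.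
Qed.

Lemma sinh_pos (t : R) : 0 < t -> 0 < sinh t.
Proof. intros Ht; rewrite <- sinh_0; now apply sinh_lt. Qed.

Lemma cosh_le (a b : R) : 0 <= a -> a <= b -> cosh a <= cosh b.
Proof.
  intros Ha Hab.
  assert (E : cosh b - cosh a = 2 * (sinh ((a + b) / 2) * sinh ((b - a) / 2))).
  { assert (E : forall p q, cosh (p + q) - cosh (p - q) = 2 * (sinh p * sinh q)).
    { intros p q. unfold cosh, sinh, Rminus.
      rewrite !Ropp_plus_distr, !exp_plus, !Ropp_involutive. field. }
    rewrite <- E. f_equal; f_equal; field. }
  assert (P : forall t, 0 <= t -> 0 <= sinh t).
  { intros t [Ht | <-]; [left; now apply sinh_pos | right; symmetry; apply sinh_0]. }
  pose proof (P ((a + b) / 2) ltac:(lra)). pose proof (P ((b - a) / 2) ltac:(lra)). nra.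
Qed.

Lemma sk_pos (K t : R) :
  K <> 0 -> 0 < t -> (0 < K -> kappa K * t < PI) -> 0 < sk K t.
Proof.
  intros HK Ht Hr. pose proof (Rmult_lt_0_compat _ _ (kappa_pos K HK) Ht).
  unfold sk; destruct (Rlt_dec 0 K).
  - apply sin_gt_0; auto.
  - now apply sinh_pos.
Qed.

(** The difference is a product of sines of half the sum and half the difference, so for [K > 0] a
    bound on [a + b] suffices and [b] may exceed [PI / kappa K]. The sum of two sides of a triangle
    can be that long. *)
Lemma sgK_ck_le (K a b : R) :
  K <> 0 -> 0 <= a -> a <= b -> (0 < K -> kappa K * (a + b) <= 2 * PI) ->
  sgK K * ck K b <= sgK K * ck K a.
Proof.
  intros HK Ha Hab Hr. pose proof (kappa_pos K HK) as Hk.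
  assert (0 <= kappa K * a) by nra.
  assert (kappa K * a <= kappa K * b) by nra.
  unfold sgK, ck; destruct (Rlt_dec 0 K).
  - specialize (Hr r). rewrite Rmult_plus_distr_l in Hr.
    pose proof (form2 (kappa K * a) (kappa K * b)) as E.
    replace ((kappa K * a - kappa K * b) / 2)
      with (- ((kappa K * b - kappa K * a) / 2)) in E by field.
    rewrite sin_neg in E.
    pose proof (sin_ge_0 ((kappa K * b - kappa K * a) / 2) ltac:(lra) ltac:(lra)).
    pose proof (sin_ge_0 ((kappa K * a + kappa K * b) / 2) ltac:(lra) ltac:(lra)).
    nra.
  - pose proof (cosh_le (kappa K * a) (kappa K * b)). lra.
Qed.

Lemma model_angle_acos (K a b c : R) : model_angle K a b c = acos (cos_model K a b c).
Proof.
  unfold model_angle, cos_model, sgK, ck, sk. cbv zeta.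
  destruct (Rlt_dec 0 K); f_equal; unfold Rdiv; ring.
Qed.

Definition model_sides (K a b c : R) : Prop :=
  0 <= a /\ 0 < b /\ 0 < c /\ a <= b + c /\ b <= a + c /\ c <= a + b /\
  (0 < K -> kappa K * (a + b + c) < 2 * PI).

Lemma model_sides_sk_pos (K a b c : R) : K <> 0 -> model_sides K a b c ->
  0 < sk K b /\ 0 < sk K c.
Proof.
  intros HK (Ha & Hb & Hc & T1 & T2 & T3 & Hr). pose proof (kappa_pos K HK).
  split; apply sk_pos; auto; intros HK'; specialize (Hr HK'); nra.
Qed.

(** The cosine would be [-1] for [a = b + c] and [1] for [a = |b - c|]; in between, monotonicity of
    [sgK K * ck K] decides. *)
Lemma cos_model_bounds (K a b c : R) : K <> 0 -> model_sides K a b c ->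
  -1 <= cos_model K a b c <= 1.
Proof.
  intros HK HS. destruct (model_sides_sk_pos _ _ _ _ HK HS) as [Sb Sc].
  destruct HS as (Ha & Hb & Hc & T1 & T2 & T3 & Hr). pose proof (kappa_pos K HK) as Hk.
  assert (Sbc : 0 < sk K b * sk K c) by now apply Rmult_lt_0_compat.
  assert (L : sgK K * ck K (b + c) <= sgK K * ck K a).
  { apply sgK_ck_le; auto. intros HK'; specialize (Hr HK'); nra. }
  assert (U : sgK K * ck K a <= sgK K * ck K (Rabs (b - c))).
  { apply sgK_ck_le; auto. apply Rabs_pos. apply Rabs_le; lra.
    intros HK'; specialize (Hr HK').
    apply Rle_trans with (kappa K * (a + b + c)); [|lra].
    apply Rmult_le_compat_l; [lra|]. unfold Rabs; destruct (Rcase_abs _); lra. }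
  replace (ck K (Rabs (b - c))) with (ck K (b - c)) in U
    by (unfold Rabs; destruct (Rcase_abs _); [rewrite ck_opp|]; reflexivity).
  rewrite ck_plus in L. rewrite ck_minus in U.
  pose proof (sgK_sq K) as S2.
  unfold cos_model. split.
  - apply Rle_div_r; auto. nra.
  - apply Rle_div_l; auto. nra.
Qed.

Lemma cos_model_ck (K a b c : R) : sk K b <> 0 -> sk K c <> 0 ->
  ck K a = ck K b * ck K c + sgK K * (sk K b * sk K c) * cos_model K a b c.
Proof.
  intros Hb Hc. unfold cos_model.
  replace (sgK K * (sk K b * sk K c) * (sgK K * (ck K a - ck K b * ck K c) / (sk K b * sk K c)))
    with ((sgK K * sgK K) * (ck K a - ck K b * ck K c)) by now field.
  rewrite sgK_sq; ring.
Qed.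

(** Up to the factor [kappa K], the right-hand side is the rate at which [sgK K * ck K z] grows when
    [x] is shortened while [y] and the angle between [x] and [y] stay fixed. The left-hand side
    expresses it by the angle between [x] and [z]. *)
Lemma cos_model_projection (K x y z : R) : sk K x <> 0 -> sk K y <> 0 -> sk K z <> 0 ->
  sk K z * cos_model K y x z =
  sk K x * ck K y - ck K x * sk K y * cos_model K z x y.
Proof.
  intros Hx Hy Hz.
  pose proof (cos_model_ck K z x y Hx Hy) as E.
  set (g := cos_model K z x y) in *. unfold cos_model. rewrite E.
  replace (ck K y - ck K x * (ck K x * ck K y + sgK K * (sk K x * sk K y) * g))
   with (ck K y * (1 - ck K x * ck K x) - sgK K * ck K x * sk K x * sk K y * g) by ring.
  replace (1 - ck K x * ck K x) with (sgK K * (sk K x * sk K x))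
    by (pose proof (ck_sk_sq K x); lra).
  transitivity ((sgK K * sgK K) * (sk K x * ck K y - ck K x * sk K y * g)); [now field|].
  rewrite sgK_sq; ring.
Qed.

(** Both sides are nonnegative, so it is enough to compare squares, where the projection formula
    eliminates the second angle. *)
Lemma sine_rule (K x y z : R) : K <> 0 ->
  model_sides K z x y -> model_sides K y x z ->
  sk K y * sin (acos (cos_model K z x y)) = sk K z * sin (acos (cos_model K y x z)).
Proof.
  intros HK H1 H2.
  destruct (model_sides_sk_pos _ _ _ _ HK H1) as [Sx Sy].
  destruct (model_sides_sk_pos _ _ _ _ HK H2) as [_ Sz].
  pose proof (cos_model_bounds _ _ _ _ HK H1) as B1.
  pose proof (cos_model_bounds _ _ _ _ HK H2) as B2.
  assert (S : forall t, 0 <= sin (acos t))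
    by (intros t; pose proof (acos_bound t); apply sin_ge_0; lra).
  apply Rsqr_inj; try (apply Rmult_le_pos; [lra | apply S]).
  rewrite !Rsqr_mult, !sin2, !cos_acos by assumption.
  pose proof (cos_model_projection K x y z ltac:(lra) ltac:(lra) ltac:(lra)) as P.
  pose proof (cos_model_ck K z x y ltac:(lra) ltac:(lra)) as E.
  set (g := cos_model K z x y) in *. set (u := cos_model K y x z) in *.
  rewrite !Rmult_minus_distr_l. rewrite <- !Rsqr_mult, P.
  pose proof (ck_sk_sq K x) as Ex. pose proof (ck_sk_sq K y) as Ey.
  pose proof (ck_sk_sq K z) as Ez. pose proof (sgK_sq K) as E2.
  assert (Ez' : sk K z * sk K z = sgK K * (1 - ck K z * ck K z)) by (rewrite <- Ez; nra).
  assert (Ex' : ck K x * ck K x = 1 - sgK K * (sk K x * sk K x)) by lra.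
  assert (Ey' : ck K y * ck K y = 1 - sgK K * (sk K y * sk K y)) by lra.
  unfold Rsqr. rewrite !Rmult_1_r, Ez', E.
  set (cx := ck K x) in *. set (cy := ck K y) in *. set (sx := sk K x) in *.
  set (sy := sk K y) in *. set (s := sgK K) in *. clearbody cx cy sx sy s g u.
  transitivity (s * (1 - (cx*cx) * (cy * cy) - 2 * s * cx * cy * sx * sy * g
     - (s * s) * (sx*sx) * (sy*sy) * g * g)
     - ((sx * sx) * (cy * cy) - 2 * sx * cy * cx * sy * g + (cx * cx) * (sy * sy) * g * g));
    [|ring].
  rewrite Ex', Ey', E2.
  replace (s * (1 - (1 - s * (sx * sx)) * (1 - s * (sy * sy)) - 2 * s * cx * cy * sx * sy * g
     - 1 * (sx * sx) * (sy * sy) * g * g))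
   with ((s*s) * (sx * sx + sy * sy - s * (sx*sx) *(sy * sy) - 2 * cx * cy * sx * sy * g)
     - s * (sx * sx) * (sy * sy) * g * g) by ring.
  rewrite E2. ring.
Qed.

(** The constant bounds the derivative for both signs of [K] and depends on [l] alone, so it is
    known before the minimizer is. *)
Lemma sk_le_linear (K l t : R) : K <> 0 -> 0 < t <= l ->
  sk K t <= kappa K * (1 + cosh (kappa K * l)) * t.
Proof.
  intros HK Ht. pose proof (kappa_pos K HK) as Hk.
  destruct (MVT_gen (sk K) 0 t (fun u => kappa K * ck K u)) as (u & Hu & E).
  - intros u _. apply is_derive_sk.
  - intros u _. apply continuity_pt_sk.
  - rewrite Rmin_left, Rmax_right in Hu by lra. rewrite sk_0 in E.
    assert (B : ck K u <= 1 + cosh (kappa K * l)).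
    { assert (0 < cosh (kappa K * l))
        by (unfold cosh; pose proof (exp_pos (kappa K * l));
            pose proof (exp_pos (- (kappa K * l))); lra).
      unfold ck; destruct (Rlt_dec 0 K).
      - pose proof (COS_bound (kappa K * u)); lra.
      - pose proof (cosh_le (kappa K * u) (kappa K * l) ltac:(nra) ltac:(nra)). lra. }
    assert (kappa K * ck K u <= kappa K * (1 + cosh (kappa K * l))) by nra.
    nra.
Qed.

(** * Shortests and upper angles *)

Definition isometric_on {M : Type} (rho : M -> M -> R) (f : R -> M) (a b : R) : Prop :=
  forall s t, a <= s <= b -> a <= t <= b -> rho (f s) (f t) = Rabs (s - t).

(** Extends a curve on [[a, b]] to the whole line without increasing parameter distances, so that
    results asking for continuity in full neighbourhoods apply. *)
Definition clamp (a b t : R) : R := Rmax a (Rmin t b).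

Lemma clamp_bounds (a b t : R) : a <= b -> a <= clamp a b t <= b.
Proof. intros H; unfold clamp, Rmax, Rmin; repeat destruct (Rle_dec _ _); lra. Qed.

Lemma clamp_id (a b t : R) : a <= t <= b -> clamp a b t = t.
Proof. intros H; unfold clamp, Rmax, Rmin; repeat destruct (Rle_dec _ _); lra. Qed.

Lemma clamp_dist (a b s t : R) : Rabs (clamp a b s - clamp a b t) <= Rabs (s - t).
Proof.
  unfold clamp, Rmax, Rmin, Rabs;
  repeat destruct (Rle_dec _ _); repeat destruct (Rcase_abs _); lra.
Qed.

Lemma metric_refl {M : Type} (rho : M -> M -> R) (x : M) : is_metric rho -> rho x x = 0.
Proof. intros (_ & H & _). now apply H. Qed.

Lemma metric_pos_neq {M : Type} (rho : M -> M -> R) (x y : M) :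
  is_metric rho -> x <> y -> 0 < rho x y.
Proof.
  intros (H0 & H1 & _) Hxy. destruct (H0 x y) as [|E]; auto.
  symmetry in E; apply H1 in E; contradiction.
Qed.

Lemma metric_lipschitz {M : Type} (rho : M -> M -> R) (x y z : M) :
  is_metric rho -> Rabs (rho x y - rho x z) <= rho y z.
Proof.
  intros (_ & _ & Hs & Ht). apply Rabs_le.
  pose proof (Ht x y z). pose proof (Ht x z y). rewrite (Hs z y) in *. lra.
Qed.

Lemma poly_sum_isometric {M : Type} (rho : M -> M -> R) (f : R -> M) (a b : R)
    (p : nat -> R) (n : nat) :
  isometric_on rho f a b -> (forall i, (i <= n)%nat -> a <= p i <= b) ->
  (forall i, (i < n)%nat -> p i <= p (S i)) ->
  poly_sum rho f p n = p n - p 0%nat.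
Proof.
  intros Hf. induction n as [|n IH]; intros Hb Hm; simpl; [ring|].
  rewrite IH by (intros; auto with arith).
  rewrite Hf by (apply Hb; lia).
  specialize (Hm n ltac:(lia)). rewrite Rabs_minus_sym, Rabs_right; lra.
Qed.

Lemma partition_bounds (a b : R) (p : nat -> R) (n : nat) :
  is_partition a b p n -> forall i, (i <= n)%nat -> a <= p i <= b.
Proof.
  intros (H0 & Hn & Hm) i Hi.
  assert (Mono : forall i j, (i <= j)%nat -> (j <= n)%nat -> p i <= p j).
  { intros i' j Hij; induction Hij; intros Hj; [lra|].
    apply Rle_trans with (p m); [apply IHHij; lia | apply Hm; lia]. }
  rewrite <- H0, <- Hn; split; apply Mono; lia.
Qed.

Lemma isometric_shortest {M : Type} (rho : M -> M -> R) (f : R -> M) (a b : R) :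
  a <= b -> isometric_on rho f a b -> shortest rho (f a) (f b) (curve_image f a b).
Proof.
  intros Hab Hf. exists f, a, b. split; [split; [exact Hab|]|].
  - intros t Ht eps He; exists eps; split; [exact He|].
    intros s Hs Hd; rewrite Hf; auto.
  - do 2 (split; [reflexivity|]). split; [|reflexivity].
    rewrite Hf by lra. rewrite Rabs_minus_sym, Rabs_right by lra.
    split.
    + intros s (p & n & Hp & ->). pose proof (partition_bounds _ _ _ _ Hp) as Hb.
      destruct Hp as (H0 & Hn & Hm).
      rewrite (poly_sum_isometric rho f a b) by assumption. lra.
    + intros u Hu. apply Hu. exists (fun i => match i with O => a | _ => b end), 1%nat.
      split; [repeat split; intros; destruct i; lra|].
      simpl. rewrite Hf by lra. rewrite Rabs_minus_sym, Rabs_right; lra.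
Qed.

(** Length equal to distance forces equality in every triangle inequality along the curve, so the
    distance [D] from [X] serves as arc length. The given parametrization may pause, hence one
    parameter is chosen for each value of [D]. *)
Lemma shortest_isometric {M : Type} (rho : M -> M -> R) (X Y : M) (S : M -> Prop) :
  is_metric rho -> shortest rho X Y S ->
  exists f, isometric_on rho f 0 (rho X Y) /\ f 0 = X /\ f (rho X Y) = Y /\
    (forall x, S x <-> curve_image f 0 (rho X Y) x).
Proof.
  intros HM (g & a & b & (Hab & Hc) & Ha & Hb & (Hub & _) & HS).
  pose proof HM as (H0 & H1 & Hs & Ht).
  set (l := rho X Y) in *. set (D := fun t => rho X (g t)).
  assert (Three : forall s t, a <= s -> s <= t -> t <= b ->
      D t = D s + rho (g s) (g t) /\ D t + rho (g t) Y = l).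
  { intros s t Has Hst Htb.
    assert (L : D s + rho (g s) (g t) + rho (g t) Y <= l).
    { apply Hub.
      exists (fun i => match i with 0%nat => a | 1%nat => s | 2%nat => t | _ => b end), 3%nat.
      split.
      - repeat split. intros i Hi.
        destruct i as [|[|[|]]]; lra || lia.
      - simpl. unfold D. rewrite Ha, Hb. ring. }
    pose proof (Ht X (g s) (g t)). pose proof (Ht X (g t) Y).
    unfold D, l in *. lra. }
  assert (Iso : forall s t, a <= s <= b -> a <= t <= b -> rho (g s) (g t) = Rabs (D s - D t)).
  { intros s t Has Hat. destruct (Rle_dec s t).
    - destruct (Three s t) as [E _]; try lra. pose proof (H0 (g s) (g t)).
      rewrite Rabs_minus_sym, Rabs_right; lra.
    - destruct (Three t s) as [E _]; try lra. pose proof (H0 (g t) (g s)).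
      rewrite (Hs (g s)). rewrite Rabs_right; lra. }
  assert (Da : D a = 0) by (unfold D; rewrite Ha; now apply metric_refl).
  assert (Db : D b = l) by (unfold D; rewrite Hb; reflexivity).
  assert (Range : forall t, a <= t <= b -> 0 <= D t <= l).
  { intros t Hat. destruct (Three t t) as [_ E]; try lra.
    pose proof (H0 (g t) Y). pose proof (H0 X (g t)). unfold D in *. lra. }
  assert (Onto : forall r, 0 <= r <= l -> exists t, a <= t <= b /\ D t = r).
  { intros r Hr.
    destruct (IVT_cor (fun t => D (clamp a b t) - r) a b) as (t & Hat & E).
    - intros t eps He.
      destruct (Hc (clamp a b t) (clamp_bounds a b t Hab) eps He) as (d & Hd & Hd').
      exists d; split; [exact Hd|]. intros s [_ Hst]. simpl in *. unfold R_dist in *.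
      replace (D (clamp a b s) - r - (D (clamp a b t) - r))
        with (D (clamp a b s) - D (clamp a b t)) by ring.
      apply Rle_lt_trans with (rho (g (clamp a b s)) (g (clamp a b t))).
      + now apply metric_lipschitz.
      + apply Hd'; [now apply clamp_bounds|].
        eapply Rle_lt_trans; [apply clamp_dist | exact Hst].
    - exact Hab.
    - rewrite !clamp_id by lra. rewrite Da, Db. nra.
    - exists t. rewrite clamp_id in E by lra. split; [assumption | lra]. }
  pose (f := fun r => g (epsilon (inhabits 0) (fun t => a <= t <= b /\ D t = r))).
  assert (Hf : forall r, 0 <= r <= l -> exists t, a <= t <= b /\ D t = r /\ f r = g t).
  { intros r Hr.
    pose proof (epsilon_spec (inhabits 0) (fun t => a <= t <= b /\ D t = r) (Onto r Hr)) as [E1 E2].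
    eexists; split; [exact E1|]. split; [exact E2 | reflexivity]. }
  (* Parameters with the same [D] give the same point, so the choice made by [epsilon] is
     immaterial. *)
  assert (HfD : forall t, a <= t <= b -> f (D t) = g t).
  { intros t Hat. destruct (Hf (D t) (Range t Hat)) as (t' & Hat' & E & ->).
    apply H1. rewrite Iso by assumption. rewrite E, Rminus_diag. apply Rabs_R0. }
  exists f. split; [|split; [|split]].
  - intros r r' Hr Hr'. destruct (Hf r Hr) as (t & Hat & <- & ->).
    destruct (Hf r' Hr') as (t' & Hat' & <- & ->). now apply Iso.
  - rewrite <- Da, HfD by lra. exact Ha.
  - rewrite <- Db, HfD by lra. exact Hb.
  - intros x. rewrite HS. split.
    + intros (t & Hat & ->). exists (D t). split; [now apply Range | now rewrite HfD].
    + intros (r & Hr & ->). destruct (Hf r Hr) as (t & Hat & _ & ->). now exists t.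
Qed.

Lemma isometric_on_sub {M : Type} (rho : M -> M -> R) (f : R -> M) (a b a' b' : R) :
  a <= a' -> b' <= b -> isometric_on rho f a b -> isometric_on rho f a' b'.
Proof. intros H1 H2 Hf s t Hs Ht; apply Hf; lra. Qed.

Lemma isometric_on_rev {M : Type} (rho : M -> M -> R) (f : R -> M) (a b : R) :
  isometric_on rho f a b -> isometric_on rho (fun t => f (- t)) (- b) (- a).
Proof.
  intros Hf s t Hs Ht. rewrite Hf by lra. rewrite Rabs_minus_sym. f_equal; ring.
Qed.

Lemma shortest_ext {M : Type} (rho : M -> M -> R) (X Y : M) (S S' : M -> Prop) :
  (forall x, S x <-> S' x) -> shortest rho X Y S -> shortest rho X Y S'.
Proof.
  intros HS (g & a & b & H1 & H2 & H3 & H4 & H5). exists g, a, b.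
  repeat (split; [assumption|]). intros x. rewrite <- HS. apply H5.
Qed.

Lemma isometric_shortest_rev {M : Type} (rho : M -> M -> R) (f : R -> M) (a b : R) :
  a <= b -> isometric_on rho f a b -> shortest rho (f b) (f a) (curve_image f a b).
Proof.
  intros Hab Hf. apply isometric_on_rev in Hf.
  apply isometric_shortest in Hf; [|lra]. rewrite !Ropp_involutive in Hf.
  revert Hf; apply shortest_ext. intros x; split.
  - intros (t & Ht & ->). exists (- t). split; [lra | reflexivity].
  - intros (t & Ht & ->). exists (- t). split; [lra | now rewrite Ropp_involutive].
Qed.

(** Provides a point of [S] at every small distance from [O]. Without points near [O] the limsup
    would range over an empty set, and [is_upper_angle] would fail for every value. *)
Definition ray {M : Type} (rho : M -> M -> R) (O : M) (S : M -> Prop) (p : R -> M) (l : R) : Prop :=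
  0 < l /\ forall h, 0 < h <= l -> S (p h) /\ rho O (p h) = h.

Lemma ray_neq {M : Type} (rho : M -> M -> R) (O : M) (S : M -> Prop) (p : R -> M) (l h : R) :
  is_metric rho -> ray rho O S p l -> 0 < h <= l -> p h <> O.
Proof.
  intros HM [_ Hp] Hh E. destruct (Hp h Hh) as [_ E']. rewrite E, metric_refl in E'; auto; lra.
Qed.

Lemma ray_start {M : Type} (rho : M -> M -> R) (f : R -> M) (a b : R) :
  a < b -> isometric_on rho f a b ->
  ray rho (f a) (curve_image f a b) (fun h => f (a + h)) (b - a).
Proof.
  intros Hab Hf; split; [lra|]. intros h Hh. split.
  - exists (a + h); split; [lra | reflexivity].
  - rewrite Hf by lra. rewrite Rabs_minus_sym, Rabs_right; lra.
Qed.

Lemma ray_end {M : Type} (rho : M -> M -> R) (f : R -> M) (a b : R) :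
  a < b -> isometric_on rho f a b ->
  ray rho (f b) (curve_image f a b) (fun h => f (b - h)) (b - a).
Proof.
  intros Hab Hf; split; [lra|]. intros h Hh. split.
  - exists (b - h); split; [lra | reflexivity].
  - rewrite Hf by lra. rewrite Rabs_right; lra.
Qed.

(** * Upper angles and the first variation of distance *)

Lemma angle0_bounds {M : Type} (rho : M -> M -> R) (X O Y : M) : 0 <= angle0 rho X O Y <= PI.
Proof. apply acos_bound. Qed.

(** The limsup is the supremum of the set [E] of values reached or exceeded arbitrarily near [O]. *)
Lemma upper_angle_exists {M : Type} (rho : M -> M -> R) (O : M) (S1 S2 : M -> Prop)
    (p q : R -> M) (l m : R) :
  is_metric rho -> ray rho O S1 p l -> ray rho O S2 q m ->
  exists theta, is_upper_angle rho O S1 S2 theta.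
Proof.
  intros HM Hp Hq.
  set (E := fun r => forall delta, 0 < delta -> exists X Y,
    S1 X /\ X <> O /\ rho O X < delta /\ S2 Y /\ Y <> O /\ rho O Y < delta /\
    r <= angle0 rho X O Y).
  destruct (completeness E) as (theta & Hub & Hlub).
  - exists PI. intros r Hr. destruct (Hr 1 Rlt_0_1) as (X & Y & _ & _ & _ & _ & _ & _ & H).
    pose proof (angle0_bounds rho X O Y). lra.
  - exists 0. intros delta Hd. destruct Hp as [Hl Hp'], Hq as [Hm Hq'].
    set (h := Rmin (delta / 2) (Rmin l m)).
    assert (Hh : 0 < h /\ h <= delta / 2 /\ h <= l /\ h <= m).
    { unfold h, Rmin; repeat destruct (Rle_dec _ _); lra. }
    destruct (Hp' h ltac:(lra)) as [A1 A2]. destruct (Hq' h ltac:(lra)) as [B1 B2].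
    exists (p h), (q h). split; [exact A1|].
    split; [apply (ray_neq rho O S1 p l h HM); [now split | lra]|].
    split; [lra|]. split; [exact B1|].
    split; [apply (ray_neq rho O S2 q m h HM); [now split | lra]|].
    split; [lra|]. apply angle0_bounds.
  - exists theta. intros eps He. split.
    + assert (N : ~ E (theta + eps)) by (intros H; apply Hub in H; lra).
      apply not_all_ex_not in N. destruct N as (delta & N).
      apply imply_to_and in N. destruct N as [Hd N].
      exists delta; split; [exact Hd|]. intros X Y H1 H2 H3 H4 H5 H6.
      apply Rnot_le_lt. intros H7. apply N. exists X, Y. tauto.
    + intros delta Hd.
      assert (N : exists r, E r /\ theta - eps < r).
      { apply NNPP. intros N. assert (theta <= theta - eps); [|lra].
        apply Hlub. intros r Hr. apply Rnot_lt_le. intros H. apply N. now exists r. }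
      destruct N as (r & Hr & Hlt). destruct (Hr delta Hd) as (X & Y & H).
      exists X, Y. repeat (split; [tauto|]). lra.
Qed.

Lemma upper_angle_bounds {M : Type} (rho : M -> M -> R) (O : M) (S1 S2 : M -> Prop) (theta : R) :
  is_upper_angle rho O S1 S2 theta -> 0 <= theta <= PI.
Proof.
  intros H. split; apply Rnot_lt_le; intros Hlt.
  - destruct (H (- theta) ltac:(lra)) as [(delta & Hd & H1) H2].
    destruct (H2 delta Hd) as (X & Y & A1 & A2 & A3 & A4 & A5 & A6 & _).
    pose proof (H1 X Y A1 A2 A3 A4 A5 A6). pose proof (angle0_bounds rho X O Y). lra.
  - destruct (H (theta - PI) ltac:(lra)) as [_ H2].
    destruct (H2 1 ltac:(lra)) as (X & Y & _ & _ & _ & _ & _ & _ & A).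
    pose proof (angle0_bounds rho X O Y). lra.
Qed.

Lemma upper_angle_restrict {M : Type} (rho : M -> M -> R) (O : M) (S1 S2 T1 T2 : M -> Prop)
    (r theta : R) :
  0 < r ->
  (forall X, T1 X -> S1 X) -> (forall X, S1 X -> rho O X < r -> T1 X) ->
  (forall X, T2 X -> S2 X) -> (forall X, S2 X -> rho O X < r -> T2 X) ->
  is_upper_angle rho O S1 S2 theta -> is_upper_angle rho O T1 T2 theta.
Proof.
  intros Hr I1 J1 I2 J2 H eps He. destruct (H eps He) as [(delta & Hd & H1) H2]. split.
  - exists delta; split; [exact Hd|]. intros; apply H1; auto.
  - intros d Hd'. destruct (H2 (Rmin d r)) as (X & Y & A1 & A2 & A3 & A4 & A5 & A6 & A7).
    { now apply Rmin_pos. }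
    pose proof (Rmin_l d r). pose proof (Rmin_r d r).
    exists X, Y. split; [apply J1; [assumption|lra]|].
    split; [assumption|]. split; [lra|]. split; [apply J2; [assumption|lra]|].
    split; [assumption|]. split; [lra|assumption].
Qed.

Lemma cos_lipschitz (a b : R) : Rabs (cos a - cos b) <= Rabs (a - b).
Proof.
  destruct (MVT_gen cos b a (fun u => - sin u)) as (u & _ & E).
  - intros; auto_derive; [exact I | ring].
  - intros; apply continuity_cos.
  - rewrite E, Rabs_mult.
    pose proof (SIN_bound u). pose proof (Rabs_pos (a - b)).
    assert (Rabs (- sin u) <= 1) by (apply Rabs_le; lra). nra.
Qed.

(** The angle is cut at [PI], where [cos] stops decreasing, because [theta] will be an upper angle
    plus an error. *)
Lemma cos_le_of_acos_lt (g theta : R) :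
  -1 <= g <= 1 -> 0 <= theta -> acos g < theta -> cos (Rmin theta PI) <= g.
Proof.
  intros Hg Ht H. rewrite <- (cos_acos g) by assumption. pose proof (acos_bound g).
  apply cos_decr_1; try lra; unfold Rmin; destruct (Rle_dec theta PI); lra.
Qed.

Lemma angle0_arg_bounds {M : Type} (rho : M -> M -> R) (X O Y : M) :
  is_metric rho -> X <> O -> Y <> O ->
  -1 <= (rho O X ^ 2 + rho O Y ^ 2 - rho X Y ^ 2) / (2 * rho O X * rho O Y) <= 1.
Proof.
  intros HM HX HY.
  assert (A : 0 < rho O X) by (apply metric_pos_neq; auto).
  assert (B : 0 < rho O Y) by (apply metric_pos_neq; auto).
  destruct HM as (H0 & _ & Hs & Ht).
  pose proof (H0 X Y). pose proof (Ht X O Y) as T1. rewrite (Hs X O) in T1.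
  pose proof (Ht O X Y) as T2. pose proof (Ht O Y X) as T3. rewrite (Hs Y X) in T3.
  assert (0 < 2 * rho O X * rho O Y) by nra.
  split; [apply Rle_div_r | apply Rle_div_l]; nra.
Qed.

(** A point [q w] near [O] is fixed first. For small [h] the Euclidean law of cosines at [O] bounds
    [rho (p h) (q w)] by [w - h * cos theta] up to [eps * h], and the triangle inequality through
    [q w] does the rest. *)
Lemma first_variation {M : Type} (rho : M -> M -> R) (O Z : M) (S1 S2 : M -> Prop)
    (p q : R -> M) (l m theta eps : R) :
  is_metric rho -> is_upper_angle rho O S1 S2 theta ->
  ray rho O S1 p l -> ray rho O S2 q m ->
  (forall w, 0 < w <= m -> rho (q w) Z = m - w) -> 0 < eps ->
  exists h0, 0 < h0 /\ forall h, 0 < h < h0 -> rho (p h) Z <= m - h * cos theta + eps * h.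
Proof.
  intros HM Hang Hp Hq HZ He.
  pose proof (upper_angle_bounds _ _ _ _ _ Hang) as Hth.
  destruct (Hang (eps / 2) ltac:(lra)) as [(delta & Hd & H1) _].
  set (w := Rmin (delta / 2) m).
  pose proof Hp as [Hl Hp']. pose proof Hq as [Hm Hq'].
  assert (Hw : 0 < w /\ w < delta /\ w <= m)
    by (unfold w, Rmin; destruct (Rle_dec _ _); lra).
  (* The bound [h < eps * w] keeps the quadratic term [h^2 / (2 w)] below [eps * h / 2]; the other
     half of [eps] pays for the error of the angle. *)
  exists (Rmin (Rmin l delta) (eps * w)).
  split; [repeat apply Rmin_pos; nra|].
  intros h [Hh Hh'].
  assert (h < l /\ h < delta /\ h < eps * w) as (A1 & A2 & A3).
  { revert Hh'; unfold Rmin; repeat destruct (Rle_dec _ _); lra. }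
  destruct (Hp' h ltac:(lra)) as [B1 B2]. destruct (Hq' w ltac:(lra)) as [C1 C2].
  assert (B3 : p h <> O) by (apply (ray_neq rho O S1 p l h HM Hp); lra).
  assert (C3 : q w <> O) by (apply (ray_neq rho O S2 q m w HM Hq); lra).
  specialize (H1 (p h) (q w) B1 B3 ltac:(lra) C1 C3 ltac:(lra)).
  unfold angle0 in H1.
  pose proof (cos_le_of_acos_lt _ (theta + eps / 2) (angle0_arg_bounds rho _ _ _ HM B3 C3)
    ltac:(lra) H1) as H2.
  rewrite B2, C2 in H2.
  apply Rle_div_r in H2; [|nra].
  assert (H3 : cos theta - eps / 2 <= cos (Rmin (theta + eps / 2) PI)).
  { pose proof (cos_lipschitz theta (Rmin (theta + eps / 2) PI)) as L.
    assert (Rabs (theta - Rmin (theta + eps / 2) PI) <= eps / 2).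
    { unfold Rmin; destruct (Rle_dec _ _); apply Rabs_le; lra. }
    assert (L' := Rle_trans _ _ _ L H). apply Rabs_le_between in L'. lra. }
  set (c' := cos (Rmin (theta + eps / 2) PI)) in *.
  destruct HM as (H0 & _ & Hs & Ht).
  pose proof (Ht (p h) (q w) Z) as T. rewrite HZ in T by lra.
  set (zz := rho (p h) (q w)) in *. assert (0 <= zz) by apply H0.
  assert (Q : zz <= w - h * c' + h * (eps / 2)).
  { assert (Sq : 2 * w * zz <= 2 * w * (w - h * c' + h * (eps / 2)));
      [|apply Rmult_le_reg_l with (2 * w); lra].
    pose proof (Rle_0_sqr (w - zz)) as Q1. unfold Rsqr in Q1.
    assert (Q2 : h * h <= h * (eps * w)) by (apply Rmult_le_compat_l; lra).
    lra. }
  nra.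
Qed.

Lemma upper_angle_straight {M : Type} (rho : M -> M -> R) (f : R -> M) (a b c : R) :
  is_metric rho -> a < b < c -> isometric_on rho f a c ->
  is_upper_angle rho (f b) (curve_image f a b) (curve_image f b c) PI.
Proof.
  intros HM Hab Hf.
  assert (A : forall s t, a <= s < b -> b < t <= c -> angle0 rho (f s) (f b) (f t) = PI).
  { intros s t Hs Ht. unfold angle0. rewrite !Hf by lra.
    rewrite (Rabs_right (b - s)), (Rabs_left (b - t)), (Rabs_left (s - t)) by lra.
    replace ((_ + _ - _) / _) with (Ropp 1) by (field; lra).
    rewrite acos_opp, acos_1; ring. }
  assert (N1 : forall s, a <= s <= b -> f s <> f b -> s < b).
  { intros s Hs Hn. destruct (proj2 Hs); [lra | subst; contradiction]. }
  assert (N2 : forall s, b <= s <= c -> f s <> f b -> b < s).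
  { intros s Hs Hn. destruct (proj1 Hs); [lra | subst; contradiction]. }
  intros eps He. split.
  - exists 1; split; [lra|]. intros X Y (s & Hs & ->) HX _ (t & Ht & ->) HY _.
    rewrite A; [lra | split; [lra|auto] | split; [auto|lra]].
  - intros delta Hd. set (h := Rmin (delta / 2) (Rmin (b - a) (c - b))).
    assert (Hh : 0 < h /\ h <= delta / 2 /\ h <= b - a /\ h <= c - b)
      by (unfold h, Rmin; repeat destruct (Rle_dec _ _); lra).
    destruct (ray_end rho f a b) as [_ R1]; [lra | apply (isometric_on_sub rho f a c); assumption || lra|].
    destruct (ray_start rho f b c) as [_ R2]; [lra | apply (isometric_on_sub rho f a c); assumption || lra|].
    destruct (R1 h ltac:(lra)) as [P1 P2]. destruct (R2 h ltac:(lra)) as [Q1 Q2].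
    exists (f (b - h)), (f (b + h)).
    split; [exact P1|]. split.
    { intros E; rewrite E, metric_refl in P2; auto; lra. }
    split; [lra|]. split; [exact Q1|]. split.
    { intros E; rewrite E, metric_refl in Q2; auto; lra. }
    split; [lra|]. rewrite A by lra. lra.
Qed.

(** * Comparison of angles and distances *)

(** If the infimum [- m] were not attained, each point would have a neighbourhood on which [f]
    exceeds it by a margin equal to the radius; compactness turns these into one margin [d], which
    contradicts the infimum. *)
Lemma lsc_min_2d (f : R -> R -> R) (a b a' b' lb : R) :
  a <= b -> a' <= b' ->
  (forall x y, a <= x <= b -> a' <= y <= b' -> lb <= f x y) ->
  (forall x y, a <= x <= b -> a' <= y <= b' -> forall eps, 0 < eps ->
     exists d, 0 < d /\ forall u v, a <= u <= b -> a' <= v <= b' ->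
       Rabs (u - x) < d -> Rabs (v - y) < d -> f x y - eps <= f u v) ->
  exists x0 y0, a <= x0 <= b /\ a' <= y0 <= b' /\
    forall x y, a <= x <= b -> a' <= y <= b' -> f x0 y0 <= f x y.
Proof.
  intros Hab Hab' Hlb Hlsc.
  set (E := fun r => exists x y, a <= x <= b /\ a' <= y <= b' /\ r = - f x y).
  destruct (completeness E) as (m & Hub & Hlub).
  { exists (- lb). intros r (x & y & Hx & Hy & ->). specialize (Hlb x y Hx Hy). lra. }
  { exists (- f a a'), a, a'. repeat split; lra. }
  apply NNPP. intros N.
  assert (Hgt : forall x y, a <= x <= b -> a' <= y <= b' -> - m < f x y).
  { intros x y Hx Hy. apply Rnot_le_lt. intros Hle. apply N. exists x, y.
    do 2 (split; [assumption|]). intros u v Hu Hv.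
    assert (- f u v <= m) by (apply Hub; exists u, v; auto). lra. }
  assert (Hd : forall x y, exists d : posreal, a <= x <= b -> a' <= y <= b' ->
      forall u v, a <= u <= b -> a' <= v <= b' ->
      Rabs (u - x) < d -> Rabs (v - y) < d -> - m + d <= f u v).
  { intros x y. destruct (classic (a <= x <= b /\ a' <= y <= b')) as [[Hx Hy]|Hn].
    - specialize (Hgt x y Hx Hy).
      destruct (Hlsc x y Hx Hy ((f x y + m) / 2)) as (d & Hd & H); [lra|].
      assert (Hd' : 0 < Rmin d ((f x y + m) / 2)) by (apply Rmin_pos; lra).
      exists (mkposreal _ Hd'). simpl. intros _ _ u v Hu Hv H1 H2.
      pose proof (Rmin_l d ((f x y + m) / 2)). pose proof (Rmin_r d ((f x y + m) / 2)).
      specialize (H u v Hu Hv ltac:(lra) ltac:(lra)). lra.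
    - exists (mkposreal 1 Rlt_0_1). tauto. }
  pose (delta := fun x y => proj1_sig (constructive_indefinite_description _ (Hd x y))).
  destruct (compactness_value_2d a b a' b' delta) as (d & H).
  assert (m <= m - d); [|pose proof (cond_pos d); lra].
  apply Hlub. intros r (x & y & Hx & Hy & ->).
  assert (- m + d <= f x y); [|lra].
  (* [compactness_value_2d] provides its covering point only under a double negation. *)
  apply NNPP. intros Hn. apply (H x y Hx Hy). intros (u & v & Hu & Hv & H1 & H2 & H3).
  apply Hn. apply Rle_trans with (- m + delta u v); [lra|].
  unfold delta in *. destruct (constructive_indefinite_description _ (Hd u v)) as [d' Hd'].
  simpl in *. now apply Hd'.
Qed.

Lemma acos_lsc (g eps : R) : -1 <= g <= 1 -> 0 < eps ->
  exists d, 0 < d /\ forall g', -1 <= g' <= 1 -> Rabs (g' - g) < d -> acos g - eps <= acos g'.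
Proof.
  intros Hg He. pose proof (acos_bound g) as B.
  destruct (Rlt_dec (acos g - eps) 0) as [Hn|Hp].
  - exists 1; split; [lra|]. intros g' _ _. pose proof (acos_bound g'). lra.
  - apply Rnot_lt_le in Hp. exists (cos (acos g - eps) - g). split.
    + rewrite <- (cos_acos g) at 2 by assumption.
      pose proof (cos_decreasing_1 (acos g - eps) (acos g)). lra.
    + intros g' Hg' Hd. apply Rabs_def2 in Hd.
      apply Rnot_lt_le. intros Hlt. pose proof (acos_bound g').
      pose proof (cos_decreasing_1 (acos g') (acos g - eps)) as Q.
      rewrite cos_acos in Q by assumption. lra.
Qed.

Lemma is_derive_le_right (f g : R -> R) (a b h0 : R) :
  is_derive f 0 a -> is_derive g 0 b -> f 0 = g 0 -> 0 < h0 ->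
  (forall h, 0 < h < h0 -> f h <= g h) -> a <= b.
Proof.
  intros Hf Hg E Hh0 H. apply is_derive_Reals in Hf. apply is_derive_Reals in Hg.
  apply Rnot_lt_le. intros Hlt.
  destruct (Hf ((a - b) / 4) ltac:(lra)) as (d1 & H1).
  destruct (Hg ((a - b) / 4) ltac:(lra)) as (d2 & H2).
  pose proof (cond_pos d1). pose proof (cond_pos d2).
  set (h := Rmin (h0 / 2) (Rmin (d1 / 2) (d2 / 2))).
  assert (Hh : 0 < h /\ h < h0 /\ h < d1 /\ h < d2)
    by (unfold h, Rmin; repeat destruct (Rle_dec _ _); lra).
  specialize (H1 h ltac:(lra) ltac:(rewrite Rabs_right; lra)).
  specialize (H2 h ltac:(lra) ltac:(rewrite Rabs_right; lra)).
  rewrite Rplus_0_l in *. apply Rabs_def2 in H1. apply Rabs_def2 in H2.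
  specialize (H h ltac:(lra)).
  assert ((f h - f 0) / h <= (g h - g 0) / h).
  { apply Rmult_le_compat_r; [left; apply Rinv_0_lt_compat; lra | lra]. }
  lra.
Qed.

(** When [x] is shortened by [h], minimality bounds the new angle from below, hence
    [sgK K * ck K (zf h)] from above by the law of cosines, while the first variation bounds it from
    below. Comparing derivatives at [h = 0] gives the claim: the projection formula identifies the
    main term, and the sine rule bounds [sk K y * sin ga] by [sk K z]. *)
Lemma shortened_side_angle (K c x y z xi h1 : R) (zf : R -> R) :
  K <> 0 -> 0 < c -> 0 < z -> model_sides K z x y -> model_sides K y x z -> 0 < h1 ->
  (forall h, 0 < h < h1 -> h < x /\ model_sides K (zf h) (x - h) y /\
     acos (cos_model K z x y) - c * ln x
     <= acos (cos_model K (zf h) (x - h) y) - c * ln (x - h)) ->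
  (forall eps, 0 < eps -> exists h0, 0 < h0 /\
     forall h, 0 < h < h0 -> zf h <= z - h * cos xi + eps * h) ->
  kappa K * x * (cos xi - cos_model K y x z) <= c * sk K x.
Proof.
  intros HK Hc Hz M1 M2 Hh1 Hmin Hvar.
  destruct (model_sides_sk_pos _ _ _ _ HK M1) as [Sx Sy].
  destruct (model_sides_sk_pos _ _ _ _ HK M2) as [_ Sz].
  pose proof (cos_model_bounds _ _ _ _ HK M1) as B1.
  pose proof (kappa_pos K HK) as Hk.
  assert (Px : 0 < x) by (destruct M1; tauto).
  assert (Py : 0 < y) by (destruct M1; tauto).
  assert (Rz : 0 < K -> kappa K * z < PI).
  { intros HK'. destruct M1 as (_ & _ & _ & T & _ & _ & Hr). specialize (Hr HK'). nra. }
  pose proof (sine_rule K x y z HK M1 M2) as SR.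
  pose proof (cos_model_projection K x y z ltac:(lra) ltac:(lra) ltac:(lra)) as PR.
  pose proof (cos_model_ck K z x y ltac:(lra) ltac:(lra)) as CZ.
  pose proof (acos_bound (cos_model K z x y)) as Bg.
  assert (Cg : cos (acos (cos_model K z x y)) = cos_model K z x y) by now apply cos_acos.
  set (g := cos_model K z x y) in *. set (u := cos_model K y x z) in *.
  set (ga := acos g) in *.
  (* For [ga = 0] the lower bound [ga + c * (ln (x - h) - ln x)] is negative, out of the range where
     [cos] decreases, so the bound [0] replaces it. The derivative is unchanged, since it carries
     the factor [sin ga]. *)
  set (cc := if Req_EM_T ga 0 then 0 else c).
  assert (Hcc : sin ga * cc = sin ga * c).
  { unfold cc; destruct (Req_EM_T ga 0) as [E|]; [rewrite E, sin_0; ring | reflexivity]. }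
  assert (Main : forall eps, 0 < eps ->
    kappa K * sk K z * (cos xi - eps) <=
    kappa K * (sk K x * ck K y - ck K x * sk K y * g) + sk K x * sk K y * (sin ga * c / x)).
  { intros eps He. destruct (Hvar eps He) as (h0 & Hh0 & Hv).
    (* [h2] keeps [zf h + (z + h * (eps - cos xi))] within [2 * PI / kappa K], as the monotonicity
       of [ck] requires for [K > 0]; [h3] below keeps the lower bound of the angle nonnegative. *)
    set (h2 := if Rlt_dec 0 K then (PI / kappa K - z) / (1 + eps) else 1).
    assert (Hh2 : 0 < h2).
    { unfold h2. destruct (Rlt_dec 0 K); [|lra]. apply Rdiv_lt_0_compat; [|lra].
      apply Rlt_0_minus, Rlt_div_r; auto. rewrite Rmult_comm; auto. }
    set (h3 := if Req_EM_T ga 0 then 1 else x * (1 - exp (- ga / c))).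
    assert (Hh3 : 0 < h3).
    { unfold h3. destruct (Req_EM_T ga 0); [lra|].
      apply Rmult_lt_0_compat; [lra|].
      assert (exp (- ga / c) < exp 0); [|rewrite exp_0 in *; lra].
      apply exp_increasing. assert (0 < ga / c) by (apply Rdiv_lt_0_compat; lra).
      unfold Rdiv in *. lra. }
    apply (is_derive_le_right
      (fun h => sgK K * ck K (z + h * (eps - cos xi)))
      (fun h => sgK K * ck K (x - h) * ck K y
                + sk K (x - h) * sk K y * cos (ga + cc * (ln (x - h) - ln x)))
      _ _ (Rmin (Rmin h0 h1) (Rmin h2 h3))).
    - auto_derive.
      + eexists; apply is_derive_ck.
      + rewrite (is_derive_unique _ _ _ (is_derive_ck K _)).
        rewrite Rmult_0_l, Rplus_0_r.
        transitivity ((sgK K * sgK K) * kappa K * sk K z * (cos xi - eps)); [ring|].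
        rewrite sgK_sq; ring.
    - auto_derive.
      + split; [eexists; apply is_derive_ck|].
        split; [eexists; apply is_derive_sk | lra].
      + rewrite (is_derive_unique _ _ _ (is_derive_ck K _)).
        rewrite (is_derive_unique _ _ _ (is_derive_sk K _)).
        rewrite Ropp_0, Rplus_0_r, Rplus_opp_r, Rmult_0_r, Rplus_0_r, Cg.
        transitivity ((sgK K * sgK K) * kappa K * sk K x * ck K y
          - kappa K * ck K x * sk K y * g + sk K x * sk K y * (sin ga * cc / x)).
        * field. lra.
        * rewrite sgK_sq, Hcc. field. lra.
    - rewrite Rmult_0_l, Rplus_0_r, Rminus_0_r, Rminus_diag, Rmult_0_r, Rplus_0_r, Cg, CZ.
      transitivity (sgK K * ck K x * ck K y + (sgK K * sgK K) * (sk K x * sk K y * g)); [ring|].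
      rewrite sgK_sq; ring.
    - repeat apply Rmin_pos; assumption.
    - intros h [Hh Hh'].
      assert (h < h0 /\ h < h1 /\ h < h2 /\ h < h3) as (A0 & A1 & A2 & A3)
        by (revert Hh'; unfold Rmin; repeat destruct (Rle_dec _ _); lra).
      destruct (Hmin h ltac:(lra)) as (Hx & Mh & Hp).
      destruct (model_sides_sk_pos _ _ _ _ HK Mh) as [Sxh _].
      pose proof (cos_model_bounds _ _ _ _ HK Mh) as Bh.
      pose proof (cos_model_ck K (zf h) (x - h) y ltac:(lra) ltac:(lra)) as Ch.
      specialize (Hv h ltac:(lra)).
      apply Rle_trans with (sgK K * ck K (zf h)).
      + assert (0 <= zf h) by (destruct Mh; tauto).
        apply sgK_ck_le; auto; [lra|]. intros HK'.
        unfold h2 in A2. destruct (Rlt_dec 0 K); [|contradiction].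
        apply Rlt_div_r in A2; [|lra].
        pose proof (COS_bound xi).
        assert (zf h + (z + h * (eps - cos xi)) <= 2 * (PI / kappa K)) by nra.
        replace (2 * PI) with (kappa K * (2 * (PI / kappa K))) by (field; lra).
        apply Rmult_le_compat_l; lra.
      + rewrite Ch.
        replace (sgK K * _) with
          (sgK K * ck K (x - h) * ck K y + (sgK K * sgK K) *
             (sk K (x - h) * sk K y * cos_model K (zf h) (x - h) y)) by ring.
        rewrite sgK_sq, Rmult_1_l. apply Rplus_le_compat_l.
        apply Rmult_le_compat_l; [apply Rmult_le_pos; lra|].
        unfold h3 in A3. unfold cc. destruct (Req_EM_T ga 0) as [E|E].
        * rewrite E, Rmult_0_l, Rplus_0_r, cos_0. lra.
        * rewrite <- (cos_acos (cos_model K (zf h) (x - h) y)) by assumption.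
          pose proof (acos_bound (cos_model K (zf h) (x - h) y)).
          assert (L1 : - ga / c < ln (x - h) - ln x).
          { rewrite <- ln_div by lra. rewrite <- (ln_exp (- ga / c)).
            apply ln_increasing; [apply exp_pos|].
            apply Rlt_div_r; lra. }
          assert (L2 : - ga < c * (ln (x - h) - ln x)).
          { replace (- ga) with (c * (- ga / c)) by (field; lra).
            apply Rmult_lt_compat_l; assumption. }
          apply cos_decr_1; lra. }
  rewrite <- PR in Main.
  assert (Main' : kappa K * sk K z * (cos xi - u) <= sk K x * sk K y * (sin ga * c / x)).
  { apply le_epsilon. intros e He.
    assert (P : 0 < kappa K * sk K z) by now apply Rmult_lt_0_compat.
    specialize (Main (e / (kappa K * sk K z)) (Rdiv_lt_0_compat _ _ He P)).
    rewrite (Rmult_minus_distr_l _ (cos xi)) in Main.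
    replace (kappa K * sk K z * (e / (kappa K * sk K z))) with e in Main by (field; lra).
    lra. }
  replace (sk K x * sk K y * (sin ga * c / x)) with
    (sk K x * (c / x) * (sk K y * sin ga)) in Main' by (field; lra).
  rewrite SR in Main'.
  assert (Su : sin (acos u) <= 1) by apply SIN_bound.
  apply Rmult_le_reg_l with (sk K z); [assumption|].
  apply Rle_trans with (x * (sk K x * (c / x) * (sk K z * sin (acos u)))).
  - replace (sk K z * (kappa K * x * (cos xi - u)))
      with (x * (kappa K * sk K z * (cos xi - u))) by ring.
    apply Rmult_le_compat_l; lra.
  - replace (x * (sk K x * (c / x) * (sk K z * sin (acos u))))
      with (sk K z * (c * sk K x) * sin (acos u)) by (field; lra).
    rewrite <- (Rmult_1_r (sk K z * (c * sk K x))) at 2.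
    apply Rmult_le_compat_l; [|assumption].
    repeat apply Rmult_le_pos; lra.
Qed.

(** Both [(u - xi) / 2] and [(xi + u) / 2] lie between [e / 2] and [PI - e / 2], so the gap does not
    depend on where the two angles are. *)
Lemma cos_drop (xi u e : R) : 0 <= xi -> u <= PI -> 0 < e -> e <= u - xi ->
  2 * (sin (e / 2) * sin (e / 2)) <= cos xi - cos u.
Proof.
  intros Hxi Hu He Hd. rewrite form2.
  replace ((xi - u) / 2) with (- ((u - xi) / 2)) by field. rewrite sin_neg.
  assert (0 < sin (e / 2)) by (apply sin_gt_0; lra).
  assert (A : sin (e / 2) <= sin ((u - xi) / 2)) by (apply sin_incr_1; lra).
  assert (B : sin (e / 2) <= sin ((xi + u) / 2)).
  { destruct (Rle_dec ((xi + u) / 2) (PI / 2)); [apply sin_incr_1; lra|].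
    rewrite <- (sin_PI_x ((xi + u) / 2)). apply sin_incr_1; lra. }
  nra.
Qed.

(** Degenerate triples are included: for [Z = X] this says [kappa K * rho X Y < PI], which makes
    [sk] positive at every nonzero distance. *)
Lemma RK_perimeter (K : R) {M : Type} (rho : M -> M -> R) (X Y Z : M) :
  RK_domain K rho -> 0 < K -> kappa K * (rho X Y + rho Y Z + rho Z X) < 2 * PI.
Proof.
  intros (_ & Hex & Hper & _) HK.
  destruct (Hex X Y) as [S1 H1], (Hex Y Z) as [S2 H2], (Hex Z X) as [S3 H3].
  specialize (Hper HK X Y Z S1 S2 S3 H1 H2 H3).
  assert (Hk : 0 < kappa K) by (apply kappa_pos; lra).
  assert (E : sqrt K = kappa K) by (unfold kappa; rewrite Rabs_right; lra).
  rewrite E in Hper. apply Rlt_div_r in Hper; lra.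
Qed.

Lemma RK_model_sides (K : R) {M : Type} (rho : M -> M -> R) (X Y Z : M) :
  RK_domain K rho -> X <> Y -> X <> Z ->
  model_sides K (rho Y Z) (rho X Y) (rho X Z).
Proof.
  intros HR HXY HXZ. pose proof (RK_perimeter K rho X Y Z HR) as P.
  destruct HR as (HM & _). pose proof HM as (H0 & _ & Hs & Ht).
  pose proof (metric_pos_neq rho _ _ HM HXY). pose proof (metric_pos_neq rho _ _ HM HXZ).
  pose proof (Ht Y X Z). pose proof (Ht X Z Y). pose proof (Ht X Y Z).
  rewrite (Hs Y X), (Hs Z Y) in *. rewrite (Hs Z X) in P.
  repeat (split; [auto; lra|]). intros HK; specialize (P HK); lra.
Qed.

Lemma curve_image_germ {M : Type} (rho : M -> M -> R) (f : R -> M) (l l' : R) (X : M) :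
  0 <= l' <= l -> isometric_on rho f 0 l ->
  curve_image f 0 l X -> rho (f 0) X < l' -> curve_image f 0 l' X.
Proof.
  intros Hl Hf (t & Ht & ->) H. exists t; split; [|reflexivity].
  rewrite Hf in H by lra. rewrite Rminus_0_l, Rabs_Ropp, Rabs_right in H; lra.
Qed.

Lemma curve_image_sub {M : Type} (f : R -> M) (l l' : R) (X : M) :
  l' <= l -> curve_image f 0 l' X -> curve_image f 0 l X.
Proof. intros Hl (t & Ht & ->). exists t; split; [lra | reflexivity]. Qed.

(* The midpoint of the second geodesic cuts the bigon into a triangle whose comparison triangle
   is degenerate with angle sum [PI], and the angle at that midpoint already is [PI]. *)
Lemma bigon_angle (K : R) {M : Type} (rho : M -> M -> R) (f1 f2 : R -> M) (l alpha : R) :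
  K <> 0 -> RK_domain K rho -> 0 < l ->
  isometric_on rho f1 0 l -> isometric_on rho f2 0 l -> f1 0 = f2 0 -> f1 l = f2 l ->
  is_upper_angle rho (f1 0) (curve_image f1 0 l) (curve_image f2 0 l) alpha -> alpha <= 0.
Proof.
  intros HK HR Hl I1 I2 E0 El Ha. pose proof HR as (HM & Hex & Hper & Hsum).
  set (m := l / 2). set (A := f1 0). set (B := f1 l). set (C := f2 m).
  assert (DAB : rho A B = l).
  { unfold A, B. rewrite I1 by lra. rewrite Rabs_left; lra. }
  assert (DBC : rho B C = m).
  { unfold B, C, m. rewrite El, I2 by lra. rewrite Rabs_right; lra. }
  assert (DAC : rho A C = m).
  { unfold A, C, m. rewrite E0, I2 by lra. rewrite Rabs_left; lra. }
  assert (NAB : A <> B) by (intros E; rewrite E, metric_refl in DAB; auto; lra).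
  assert (NBC : B <> C) by (intros E; rewrite E, metric_refl in DBC; auto; unfold m in *; lra).
  assert (NAC : A <> C) by (intros E; rewrite E, metric_refl in DAC; auto; unfold m in *; lra).
  assert (I2a : isometric_on rho f2 0 m) by (apply (isometric_on_sub rho f2 0 l); unfold m; auto; lra).
  assert (I2b : isometric_on rho f2 m l) by (apply (isometric_on_sub rho f2 0 l); unfold m; auto; lra).
  assert (SAB : shortest rho A B (curve_image f1 0 l)) by (apply isometric_shortest; auto; lra).
  assert (SBC : shortest rho B C (curve_image f2 m l)).
  { unfold B, C. rewrite El. apply isometric_shortest_rev; auto; unfold m; lra. }
  assert (SCA : shortest rho C A (curve_image f2 0 m)).
  { unfold A, C. rewrite E0. apply isometric_shortest_rev; auto; unfold m; lra. }
  assert (UA : is_upper_angle rho A (curve_image f1 0 l) (curve_image f2 0 m) alpha).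
  { revert Ha. apply upper_angle_restrict with m; auto; [unfold m; lra| |].
    - intros X. apply curve_image_sub. unfold m; lra.
    - intros X HX Hd. apply (curve_image_germ rho f2 l); auto; [unfold m; lra|].
      rewrite <- E0. exact Hd. }
  destruct (upper_angle_exists rho B (curve_image f1 0 l) (curve_image f2 m l)
     (fun h => f1 (l - h)) (fun h => f2 (l - h)) (l - 0) (l - m)) as (tB & UB); auto.
  { apply ray_end; auto. }
  { unfold B. rewrite El. apply ray_end; auto. unfold m; lra. }
  assert (UC : is_upper_angle rho C (curve_image f2 0 m) (curve_image f2 m l) PI).
  { apply upper_angle_straight; auto. unfold m; lra. }
  pose proof (Hsum A B C _ _ _ NAB NBC (not_eq_sym NAC) SAB SBC SCA _ _ _ UA UB UC) as Q.
  pose proof (upper_angle_bounds _ _ _ _ _ UB).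
  unfold angleK in Q. rewrite !model_angle_acos in Q.
  destruct HM as (_ & _ & Hs & _).
  rewrite (Hs B A), (Hs C A), (Hs C B), DAB, DBC, DAC in Q.
  assert (Mm : model_sides K m l m).
  { rewrite <- DBC at 1. rewrite <- DAB at 1. rewrite <- DAC at 1.
    apply RK_model_sides; auto. }
  destruct (model_sides_sk_pos _ _ _ _ HK Mm) as [Sl Sm].
  assert (El2 : l = m + m) by (unfold m; field).
  pose proof (ck_plus K m m) as Cl. pose proof (sk_plus K m m) as Sl'. rewrite <- El2 in Cl, Sl'.
  pose proof (ck_sk_sq K m) as Sq. pose proof (sgK_sq K) as Sg.
  assert (C1 : cos_model K m l m = 1).
  { unfold cos_model. apply Rmult_eq_reg_r with (sk K l * sk K m); [|nra].
    unfold Rdiv. rewrite Rmult_assoc, Rinv_l, Rmult_1_r, Rmult_1_l by nra.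
    rewrite Cl, Sl'.
    replace (sgK K * (ck K m - (ck K m * ck K m - sgK K * (sk K m * sk K m)) * ck K m))
      with (sgK K * ck K m * (1 - ck K m * ck K m + sgK K * (sk K m * sk K m))) by ring.
    replace (1 - ck K m * ck K m) with (sgK K * (sk K m * sk K m)) by lra.
    transitivity ((sgK K * sgK K) * (2 * ck K m * (sk K m * sk K m))); [ring|].
    rewrite Sg; ring. }
  assert (C2 : cos_model K l m m = -1).
  { unfold cos_model. apply Rmult_eq_reg_r with (sk K m * sk K m); [|nra].
    unfold Rdiv. rewrite Rmult_assoc, Rinv_l, Rmult_1_r by nra.
    rewrite Cl. transitivity (- (sgK K * sgK K) * (sk K m * sk K m)); [ring|].
    rewrite Sg; ring. }
  rewrite C1, C2 in Q. change (-1) with (Ropp 1) in Q. rewrite acos_opp, acos_1 in Q. lra.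
Qed.

Theorem angle_comparison (K : R) {M : Type} (rho : M -> M -> R) (f1 f2 : R -> M) (l1 l2 alpha : R) :
  K <> 0 -> RK_domain K rho -> 0 < l1 -> 0 < l2 ->
  isometric_on rho f1 0 l1 -> isometric_on rho f2 0 l2 -> f1 0 = f2 0 ->
  is_upper_angle rho (f1 0) (curve_image f1 0 l1) (curve_image f2 0 l2) alpha ->
  cos_model K (rho (f1 l1) (f2 l2)) l1 l2 <= cos alpha.
Proof.
  intros HK HR Hl1 Hl2 I1 I2 E0 Ha. pose proof HR as (HM & Hex & Hper & Hsum).
  pose proof HM as (H0 & Hid & Hs & Ht).
  pose proof (upper_angle_bounds _ _ _ _ _ Ha) as Ba.
  assert (D1 : forall x, 0 <= x <= l1 -> rho (f1 0) (f1 x) = x).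
  { intros x Hx. rewrite I1 by lra. rewrite Rminus_0_l, Rabs_Ropp, Rabs_right; lra. }
  assert (D2 : forall y, 0 <= y <= l2 -> rho (f1 0) (f2 y) = y).
  { intros y Hy. rewrite E0, I2 by lra. rewrite Rminus_0_l, Rabs_Ropp, Rabs_right; lra. }
  assert (N1 : forall x, 0 < x <= l1 -> f1 0 <> f1 x).
  { intros x Hx E. specialize (D1 x ltac:(lra)). rewrite <- E, metric_refl in D1; auto; lra. }
  assert (N2 : forall y, 0 < y <= l2 -> f1 0 <> f2 y).
  { intros y Hy E. specialize (D2 y ltac:(lra)). rewrite <- E, metric_refl in D2; auto; lra. }
  assert (MS : forall x y, 0 < x <= l1 -> 0 < y <= l2 ->
      model_sides K (rho (f1 x) (f2 y)) x y).
  { intros x y Hx Hy. rewrite <- (D1 x) at 2 by lra. rewrite <- (D2 y) at 2 by lra.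
    apply RK_model_sides; auto. }
  apply Rnot_lt_le. intros Hlt.
  set (G := fun x y => cos_model K (rho (f1 x) (f2 y)) x y).
  fold (G l1 l2) in Hlt.
  assert (GB : forall x y, 0 < x <= l1 -> 0 < y <= l2 -> -1 <= G x y <= 1).
  { intros x y Hx Hy. apply cos_model_bounds; auto. }
  set (g1 := acos (G l1 l2)).
  pose proof (acos_bound (G l1 l2)) as Bg1. fold g1 in Bg1.
  assert (Hg1 : g1 < alpha).
  { apply Rnot_le_lt. intros Hle.
    assert (cos g1 <= cos alpha) by (apply cos_decr_1; lra).
    unfold g1 in H. rewrite cos_acos in H by (apply GB; lra). lra. }
  set (e := (alpha - g1) / 2).
  set (lm := Rmax l1 l2).
  pose proof (Rmax_l l1 l2). pose proof (Rmax_r l1 l2). fold lm in H, H1.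
  set (Cm := 1 + cosh (kappa K * lm)).
  assert (HCm : 0 < Cm).
  { unfold Cm, cosh. pose proof (exp_pos (kappa K * lm)).
    pose proof (exp_pos (- (kappa K * lm))). lra. }
  assert (Hse : 0 < sin (e / 2)) by (apply sin_gt_0; unfold e; lra).
  (* The cosines of the base angles will be off by at most [c * Cm], which is half of the gap that
     [cos_drop] finds for an angle defect of [e]. *)
  set (c := sin (e / 2) * sin (e / 2) / Cm).
  assert (Hc : 0 < c) by (apply Rdiv_lt_0_compat; [apply Rmult_lt_0_compat|]; assumption).
  assert (HcC : c * Cm = sin (e / 2) * sin (e / 2)) by (unfold c; field; lra).
  (* On the edges [x = q * l1] and [y = q * l2] the penalty exceeds its value at [(l1, l2)] by at
     least [g1 + 1], so the minimum is not attained there. It may lie on the opposite edges, since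
     the sides will only be shortened. *)
  set (q := exp (- ((g1 + 1) / c))).
  assert (Hq : 0 < q < 1).
  { split; [apply exp_pos|]. unfold q. apply Rlt_le_trans with (exp 0); [|right; apply exp_0].
    apply exp_increasing.
    assert (0 < (g1 + 1) / c) by (apply Rdiv_lt_0_compat; lra). lra. }
  assert (Lq : c * ln q = - (g1 + 1)) by (unfold q; rewrite ln_exp; field; lra).
  set (Psi := fun x y => acos (G x y) - c * (ln x + ln y)).
  assert (Hd1 : 0 < q * l1 < l1) by nra.
  assert (Hd2 : 0 < q * l2 < l2) by nra.
  assert (lnle : forall s t, 0 < s -> s <= t -> ln s <= ln t).
  { intros s t Hs0 [Hst | ->]; [left; now apply ln_increasing | lra]. }
  destruct (lsc_min_2d Psi (q * l1) l1 (q * l2) l2 (- c * (ln l1 + ln l2)))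
    as (x0 & y0 & Hx0 & Hy0 & Hmin); try lra.
  { intros x y Hx Hy. unfold Psi. pose proof (acos_bound (G x y)).
    pose proof (lnle x l1 ltac:(lra) ltac:(lra)). pose proof (lnle y l2 ltac:(lra) ltac:(lra)).
    nra. }
  { intros x y Hx Hy eps He.
    destruct (acos_lsc (G x y) (eps / 2)) as (d & Hd & Hac); [apply GB; lra | lra|].
    (* [continuity_2d_pt] concerns a full neighbourhood, whereas [f1] and [f2] are controlled only
       on their intervals. *)
    set (Z := fun u v => rho (f1 (clamp 0 l1 u)) (f2 (clamp 0 l2 v))).
    assert (CZ : continuity_2d_pt Z x y).
    { intros ep. pose proof (cond_pos ep).
      assert (Hep : 0 < ep / 2) by lra. exists (mkposreal _ Hep). simpl.
      intros u v Hu Hv. unfold Z.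
      set (a := f1 (clamp 0 l1 u)). set (b := f2 (clamp 0 l2 v)).
      set (a' := f1 (clamp 0 l1 x)). set (b' := f2 (clamp 0 l2 y)).
      assert (A1 : rho a a' <= Rabs (u - x)).
      { unfold a, a'. rewrite I1 by (apply clamp_bounds; lra). apply clamp_dist. }
      assert (A2 : rho b b' <= Rabs (v - y)).
      { unfold b, b'. rewrite I2 by (apply clamp_bounds; lra). apply clamp_dist. }
      pose proof (metric_lipschitz rho a b b' HM) as L1.
      pose proof (metric_lipschitz rho b' a a' HM) as L2.
      rewrite (Hs b' a), (Hs b' a') in L2.
      replace (rho a b - rho a' b') with ((rho a b - rho a b') + (rho a b' - rho a' b')) by ring.
      eapply Rle_lt_trans; [apply Rabs_triang|]. lra. }
    assert (CL : continuity_2d_pt (fun u v => cos_model K (Z u v) u v) x y).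
    { destruct (model_sides_sk_pos _ _ _ _ HK (MS x y ltac:(lra) ltac:(lra))) as [Sx Sy].
      unfold cos_model, Rdiv. apply continuity_2d_pt_mult.
      - apply continuity_2d_pt_mult; [apply continuity_2d_pt_const|].
        apply continuity_2d_pt_minus.
        + apply continuity_1d_2d_pt_comp; [apply continuity_pt_ck | exact CZ].
        + apply continuity_2d_pt_mult.
          * apply continuity_1d_2d_pt_comp; [apply continuity_pt_ck | apply continuity_2d_pt_id1].
          * apply continuity_1d_2d_pt_comp; [apply continuity_pt_ck | apply continuity_2d_pt_id2].
      - apply continuity_2d_pt_inv; [|nra]. apply continuity_2d_pt_mult.
        + apply continuity_1d_2d_pt_comp; [apply continuity_pt_sk | apply continuity_2d_pt_id1].
        + apply continuity_1d_2d_pt_comp; [apply continuity_pt_sk | apply continuity_2d_pt_id2]. }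
    assert (CN : continuity_2d_pt (fun u v => c * (ln u + ln v)) x y).
    { assert (Cln : forall t, 0 < t -> continuity_pt ln t).
      { intros t Ht0. apply derivable_continuous_pt. exists (/ t).
        now apply derivable_pt_lim_ln. }
      apply continuity_2d_pt_mult; [apply continuity_2d_pt_const|].
      apply continuity_2d_pt_plus.
      - apply continuity_1d_2d_pt_comp; [apply Cln; lra | apply continuity_2d_pt_id1].
      - apply continuity_1d_2d_pt_comp; [apply Cln; lra | apply continuity_2d_pt_id2]. }
    destruct (CL (mkposreal d Hd)) as (d1 & Hd1').
    assert (He2 : 0 < eps / 2) by lra.
    destruct (CN (mkposreal _ He2)) as (d2 & Hd2'). simpl in Hd1', Hd2'.
    exists (Rmin d1 d2). split; [apply Rmin_pos; apply cond_pos|].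
    intros u v Hu Hv H2 H3. pose proof (Rmin_l d1 d2). pose proof (Rmin_r d1 d2).
    specialize (Hd1' u v ltac:(lra) ltac:(lra)). specialize (Hd2' u v ltac:(lra) ltac:(lra)).
    unfold Z in Hd1'. rewrite !clamp_id in Hd1' by lra.
    fold (G u v) (G x y) in Hd1'.
    specialize (Hac (G u v) (GB u v ltac:(lra) ltac:(lra)) Hd1').
    apply Rabs_def2 in Hd2'. unfold Psi. lra. }
  assert (Hm1 := Hmin l1 l2 ltac:(lra) ltac:(lra)).
  unfold Psi in Hm1. fold g1 in Hm1.
  pose proof (acos_bound (G x0 y0)) as Bg0.
  pose proof (lnle x0 l1 ltac:(lra) ltac:(lra)) as Lx.
  pose proof (lnle y0 l2 ltac:(lra) ltac:(lra)) as Ly.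
  assert (Px : q * l1 < x0).
  { destruct (proj1 Hx0) as [|E]; [assumption|exfalso].
    assert (El : ln x0 = ln q + ln l1) by (rewrite <- E; apply ln_mult; lra).
    rewrite El in Hm1. rewrite !Rmult_plus_distr_l, Lq in Hm1.
    pose proof (Rmult_le_compat_l c _ _ (Rlt_le _ _ Hc) Lx).
    pose proof (Rmult_le_compat_l c _ _ (Rlt_le _ _ Hc) Ly). lra. }
  assert (Py : q * l2 < y0).
  { destruct (proj1 Hy0) as [|E]; [assumption|exfalso].
    assert (El : ln y0 = ln q + ln l2) by (rewrite <- E; apply ln_mult; lra).
    rewrite El in Hm1. rewrite !Rmult_plus_distr_l, Lq in Hm1.
    pose proof (Rmult_le_compat_l c _ _ (Rlt_le _ _ Hc) Lx).
    pose proof (Rmult_le_compat_l c _ _ (Rlt_le _ _ Hc) Ly). lra. }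
  (* The penalty is at least as large at the minimizer as at [(l1, l2)], so the angle cannot be
     larger. *)
  assert (Hg0 : acos (G x0 y0) <= g1).
  { pose proof (Rmult_le_compat_l c _ _ (Rlt_le _ _ Hc) Lx).
    pose proof (Rmult_le_compat_l c _ _ (Rlt_le _ _ Hc) Ly). lra. }
  set (X := f1 x0). set (Y := f2 y0).
  assert (UA : is_upper_angle rho (f1 0) (curve_image f1 0 x0) (curve_image f2 0 y0) alpha).
  { revert Ha. apply upper_angle_restrict with (Rmin x0 y0); [apply Rmin_pos; lra | | | |].
    - intros P; apply curve_image_sub; lra.
    - intros P HP Hd. pose proof (Rmin_l x0 y0).
      apply (curve_image_germ rho f1 l1); auto; lra.
    - intros P; apply curve_image_sub; lra.
    - intros P HP Hd. pose proof (Rmin_r x0 y0).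
      apply (curve_image_germ rho f2 l2); auto; [lra|]. rewrite <- E0; lra. }
  assert (I1' : isometric_on rho f1 0 x0) by (apply (isometric_on_sub rho f1 0 l1); auto; lra).
  assert (I2' : isometric_on rho f2 0 y0) by (apply (isometric_on_sub rho f2 0 l2); auto; lra).
  (* The angle-sum condition asks for distinct vertices. If [X = Y], the two shortests form a bigon,
     whose angle is zero, against [0 <= g1 < alpha]. *)
  destruct (classic (X = Y)) as [EXY | NXY].
  { assert (x0 = y0).
    { rewrite <- (D1 x0), <- (D2 y0) by lra. f_equal. exact EXY. }
    assert (alpha <= 0); [|lra].
    subst y0. apply (bigon_angle K rho f1 f2 x0); auto; lra. }
  destruct (Hex X Y) as (SXY & HXY).
  destruct (shortest_isometric rho X Y SXY HM HXY) as (f3 & I3 & F30 & F3z & HS).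
  pose proof (metric_pos_neq rho X Y HM NXY) as Pz.
  set (z := rho X Y) in *.
  assert (R3X : ray rho X SXY f3 z).
  { split; [exact Pz|]. intros h Hh. split.
    - apply HS. exists h. split; [lra | reflexivity].
    - rewrite <- F30, I3 by lra. rewrite Rminus_0_l, Rabs_Ropp, Rabs_right; lra. }
  assert (R3Y : ray rho Y SXY (fun h => f3 (z - h)) z).
  { split; [exact Pz|]. intros h Hh. split.
    - apply HS. exists (z - h). split; [lra | reflexivity].
    - rewrite <- F3z, I3 by lra. rewrite Rabs_right; lra. }
  pose proof (ray_end rho f1 0 x0 ltac:(lra) I1') as R1.
  pose proof (ray_end rho f2 0 y0 ltac:(lra) I2') as R2. fold X in R1. fold Y in R2.
  destruct (upper_angle_exists rho X _ SXY _ _ _ _ HM R1 R3X) as (xi & UX).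
  destruct (upper_angle_exists rho Y _ SXY _ _ _ _ HM R2 R3Y) as (eta & UY).
  pose proof (upper_angle_bounds _ _ _ _ _ UX) as Bxi.
  pose proof (upper_angle_bounds _ _ _ _ _ UY) as Beta.
  pose proof (Hsum (f1 0) X Y (curve_image f1 0 x0) SXY (curve_image f2 0 y0)
    (N1 x0 ltac:(lra)) NXY (not_eq_sym (N2 y0 ltac:(lra)))
    (isometric_shortest rho f1 0 x0 ltac:(lra) I1') HXY
    (eq_rect_r (fun O => shortest rho Y O (curve_image f2 0 y0))
      (isometric_shortest_rev rho f2 0 y0 ltac:(lra) I2') E0) _ _ _ UA UX UY) as Q.
  unfold angleK in Q. rewrite !model_angle_acos in Q.
  rewrite (Hs X (f1 0)), (Hs Y (f1 0)), (Hs Y X) in Q.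
  assert (DX : rho (f1 0) X = x0) by (apply D1; lra).
  assert (DY : rho (f1 0) Y = y0) by (apply D2; lra).
  rewrite DX, DY in Q. fold z in Q.
  assert (MX : model_sides K y0 x0 z).
  { rewrite <- (D2 y0), <- (D1 x0), (Hs (f1 0) (f1 x0)) by lra.
    apply RK_model_sides; auto. apply not_eq_sym, N1; lra. }
  assert (MY : model_sides K x0 y0 z).
  { rewrite <- (D2 y0), <- (D1 x0), (Hs (f1 0) (f2 y0)) by lra. unfold z. rewrite (Hs X Y).
    apply RK_model_sides; auto. apply not_eq_sym, N2; lra. }
  assert (VX : forall eps, 0 < eps -> exists h0, 0 < h0 /\ forall h, 0 < h < h0 ->
     rho (f1 (x0 - h)) Y <= z - h * cos xi + eps * h).
  { intros eps He. apply (first_variation rho X Y (curve_image f1 0 x0) SXY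
      (fun h => f1 (x0 - h)) f3 (x0 - 0)); auto.
    intros w Hw. rewrite <- F3z, I3 by lra. rewrite Rabs_minus_sym, Rabs_right; lra. }
  assert (VY : forall eps, 0 < eps -> exists h0, 0 < h0 /\ forall h, 0 < h < h0 ->
     rho (f2 (y0 - h)) X <= z - h * cos eta + eps * h).
  { intros eps He.
    apply (first_variation rho Y X (curve_image f2 0 y0) SXY
      (fun h => f2 (y0 - h)) (fun h => f3 (z - h)) (y0 - 0)); auto.
    intros w Hw. rewrite <- F30, I3 by lra. rewrite Rabs_right; lra. }
  assert (KX := shortened_side_angle K c x0 y0 z xi (x0 - q * l1) (fun h => rho (f1 (x0 - h)) Y)
     HK Hc Pz (MS x0 y0 ltac:(lra) ltac:(lra)) MX ltac:(lra)).
  assert (sym : forall a b d, cos_model K a b d = cos_model K a d b).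
  { intros a b d. unfold cos_model. rewrite (Rmult_comm (ck K b)), (Rmult_comm (sk K b)).
    reflexivity. }
  assert (MS' : forall x y, 0 < x <= l1 -> 0 < y <= l2 -> model_sides K (rho (f1 x) (f2 y)) y x).
  { intros x y Hx Hy. destruct (MS x y Hx Hy) as (A1 & A2 & A3 & A4 & A5 & A6 & A7).
    repeat (split; [lra|]). intros HK'. specialize (A7 HK'). lra. }
  assert (KY := shortened_side_angle K c y0 x0 z eta (y0 - q * l2) (fun h => rho (f2 (y0 - h)) X)
     HK Hc Pz (MS' x0 y0 ltac:(lra) ltac:(lra)) MY ltac:(lra)).
  assert (KX' : kappa K * x0 * (cos xi - cos_model K y0 x0 z) <= c * sk K x0).
  { apply KX; [|exact VX]. intros h Hh. split; [lra|]. split; [apply MS; lra|].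
    pose proof (Hmin (x0 - h) y0 ltac:(lra) ltac:(lra)) as Q'. unfold Psi, G in Q'.
    fold X Y z in Q'. lra. }
  assert (KY' : kappa K * y0 * (cos eta - cos_model K x0 y0 z) <= c * sk K y0).
  { apply KY; [|exact VY]. intros h Hh. split; [lra|].
    rewrite (Hs (f2 (y0 - h)) X). split; [apply MS'; lra|].
    pose proof (Hmin x0 (y0 - h) ltac:(lra) ltac:(lra)) as Q'. unfold Psi, G in Q'.
    fold X Y z in Q'. rewrite (sym z y0 x0), (sym _ (y0 - h) x0). lra. }
  clear KX KY. pose proof (kappa_pos K HK) as Hk.
  pose proof (sk_le_linear K lm x0 HK ltac:(lra)) as SX.
  pose proof (sk_le_linear K lm y0 HK ltac:(lra)) as SY. fold Cm in SX, SY.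
  assert (Fin : forall t th a, 0 < t -> kappa K * t * (cos th - a) <= c * sk K t ->
     sk K t <= kappa K * Cm * t -> -1 <= a <= 1 -> 0 <= th -> e <= acos a - th -> False).
  { intros t th a Pt P1 P2 Hb Hth P3.
    pose proof (acos_bound a).
    pose proof (cos_drop th (acos a) e Hth ltac:(lra) ltac:(unfold e; lra) P3) as P4.
    rewrite cos_acos in P4 by assumption.
    assert (P5 : kappa K * t * (cos th - a) <= kappa K * t * (c * Cm)).
    { eapply Rle_trans; [exact P1|].
      replace (kappa K * t * (c * Cm)) with (c * (kappa K * Cm * t)) by ring.
      apply Rmult_le_compat_l; lra. }
    apply Rmult_le_reg_l in P5; [|now apply Rmult_lt_0_compat].
    assert (0 < sin (e / 2) * sin (e / 2)) by now apply Rmult_lt_0_compat. lra. }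
  assert (Z0 : acos (G x0 y0) = acos (cos_model K z x0 y0)) by reflexivity.
  destruct (Rle_dec e (acos (cos_model K y0 x0 z) - xi)) as [L | L].
  - apply (Fin x0 xi (cos_model K y0 x0 z)); auto; try lra. now apply cos_model_bounds.
  - apply (Fin y0 eta (cos_model K x0 y0 z)); auto; try lra; [now apply cos_model_bounds|].
    unfold e in *. lra.
Qed.

(** In the model plane [sk K b] times the vector [f p] is [sk K (b - p)] times [f 0] plus [sk K p]
    times [f b], and equality holds. Here the laws of cosines at [f p] for the two halves are
    combined with these weights, which leaves the sum of the two comparison cosines; it is at most
    [cos w1 + cos w2]. *)
Theorem cevian_comparison (K : R) {M : Type} (rho : M -> M -> R) (A : M) (f : R -> M) (b p : R) :
  K <> 0 -> RK_domain K rho -> isometric_on rho f 0 b -> 0 <= p <= b ->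
  sgK K * (ck K (rho A (f 0)) * sk K (b - p) + ck K (rho A (f b)) * sk K p)
  <= sgK K * (ck K (rho A (f p)) * sk K b).
Proof.
  intros HK HR If Hp. pose proof HR as (HM & Hex & _ & _). pose proof HM as (_ & _ & Hs & Ht).
  destruct (Req_dec p 0) as [-> | Np0].
  { rewrite Rminus_0_r, sk_0. right; ring. }
  destruct (Req_dec p b) as [-> | Npb].
  { rewrite Rminus_diag, sk_0. right; ring. }
  destruct (classic (f p = A)) as [<- | NA].
  { rewrite !If by lra. rewrite !Rminus_0_r, Rminus_diag, Rabs_R0, ck_0.
    rewrite (Rabs_right p), (Rabs_left (p - b)) by lra.
    replace (- (p - b)) with (b - p) by ring. right. f_equal. rewrite Rmult_1_l.
    replace b with (p + (b - p)) at 3 by ring. rewrite sk_plus. ring. }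
  destruct (Hex (f p) A) as (SA & HSA).
  destruct (shortest_isometric rho (f p) A SA HM HSA) as (f3 & I3 & F30 & F3d & _).
  pose proof (metric_pos_neq rho _ _ HM NA) as Pd. set (d := rho (f p) A) in *.
  set (fP := fun t => f (p - t)). set (fQ := fun t => f (p + t)).
  assert (IP : isometric_on rho fP 0 p).
  { intros s t H1 H2. unfold fP. rewrite If by lra. rewrite Rabs_minus_sym. f_equal; ring. }
  assert (IQ : isometric_on rho fQ 0 (b - p)).
  { intros s t H1 H2. unfold fQ. rewrite If by lra. f_equal; ring. }
  assert (P0 : fP 0 = f p) by (unfold fP; f_equal; ring).
  assert (Q0 : fQ 0 = f p) by (unfold fQ; f_equal; ring).
  pose proof (ray_start rho f3 0 d Pd I3) as R3.
  pose proof (ray_start rho fP 0 p ltac:(lra) IP) as RP.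
  pose proof (ray_start rho fQ 0 (b - p) ltac:(lra) IQ) as RQ.
  rewrite F30 in R3. rewrite P0 in RP. rewrite Q0 in RQ.
  destruct (upper_angle_exists rho (f p) _ _ _ _ _ _ HM R3 RP) as (w1 & U1).
  destruct (upper_angle_exists rho (f p) _ _ _ _ _ _ HM R3 RQ) as (w2 & U2).
  (* A move from [f p] towards [A] changes the distances to the two ends at rates at most [- cos w1]
     and [- cos w2], and their sum cannot fall below [b]. *)
  assert (Adj : cos w1 + cos w2 <= 0).
  { apply le_epsilon. intros e He.
    destruct (first_variation rho (f p) (f 0) _ _ _ _ _ _ w1 (e / 2) HM U1 R3 RP)
      as (h1 & Hh1 & V1); [|lra|].
    { intros w Hw. unfold fP. rewrite If by lra. rewrite Rabs_right; lra. }
    destruct (first_variation rho (f p) (f b) _ _ _ _ _ _ w2 (e / 2) HM U2 R3 RQ)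
      as (h2 & Hh2 & V2); [|lra|].
    { intros w Hw. unfold fQ. rewrite If by lra. rewrite Rabs_left1; lra. }
    set (h := Rmin h1 h2 / 2).
    assert (Hh : 0 < h < h1 /\ h < h2)
      by (unfold h, Rmin; destruct (Rle_dec _ _); lra).
    specialize (V1 h ltac:(lra)). specialize (V2 h ltac:(lra)).
    pose proof (Ht (f 0) (f3 (0 + h)) (f b)) as T. rewrite (Hs (f 0) (f3 (0 + h))) in T.
    rewrite (If 0 b) in T by lra. rewrite Rabs_left1 in T by lra.
    assert (h * (cos w1 + cos w2) <= h * e) by lra.
    rewrite Rplus_0_l. apply Rmult_le_reg_l with h; lra. }
  assert (G1 : cos_model K (rho A (f 0)) d p <= cos w1).
  { replace (rho A (f 0)) with (rho (f3 d) (fP p)) by (rewrite F3d; unfold fP; repeat f_equal; ring).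
    apply (angle_comparison K rho); auto; try lra; [congruence | now rewrite F30]. }
  assert (G2 : cos_model K (rho A (f b)) d (b - p) <= cos w2).
  { replace (rho A (f b)) with (rho (f3 d) (fQ (b - p)))
      by (rewrite F3d; unfold fQ; repeat f_equal; ring).
    apply (angle_comparison K rho); auto; try lra; [congruence | now rewrite F30]. }
  assert (rng : forall X Y : M, 0 < rho X Y -> 0 < sk K (rho X Y)).
  { intros X Y HXY. apply sk_pos; auto. intros HK'.
    pose proof (RK_perimeter K rho X Y X HR HK') as P.
    rewrite (Hs Y X), (metric_refl rho X HM) in P. lra. }
  assert (Sd : 0 < sk K d) by (now apply rng).
  assert (Sp : 0 < sk K p).
  { assert (E : rho (f p) (f 0) = p) by (rewrite If by lra; rewrite Rabs_right; lra).
    rewrite <- E. apply rng; lra. }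
  assert (Sq : 0 < sk K (b - p)).
  { assert (E : rho (f b) (f p) = b - p) by (rewrite If by lra; rewrite Rabs_right; lra).
    rewrite <- E. apply rng; lra. }
  rewrite (Hs A (f p)). fold d.
  pose proof (cos_model_ck K (rho A (f 0)) d p ltac:(lra) ltac:(lra)) as E1.
  pose proof (cos_model_ck K (rho A (f b)) d (b - p) ltac:(lra) ltac:(lra)) as E2.
  rewrite E1, E2.
  set (g1 := cos_model K (rho A (f 0)) d p) in *.
  set (g2 := cos_model K (rho A (f b)) d (b - p)) in *.
  replace (sk K b) with (sk K (p + (b - p))) by (f_equal; ring). rewrite sk_plus.
  assert (Le : sk K d * sk K p * sk K (b - p) * (g1 + g2) <= 0).
  { assert (0 < sk K d * sk K p * sk K (b - p)) by (repeat apply Rmult_lt_0_compat; auto).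
    nra. }
  assert (Hyp : forall u, u = (sgK K * sgK K) * u) by (intros; rewrite sgK_sq; ring).
  rewrite (Hyp (sk K d * sk K p * sk K (b - p) * (g1 + g2))) in Le. lra.
Qed.

(** * The four-point inequality *)

Lemma ck_ge_m1 (K t : R) : -1 <= ck K t.
Proof.
  unfold ck; destruct (Rlt_dec 0 K); [apply COS_bound|].
  unfold cosh. pose proof (exp_pos (kappa K * t)). pose proof (exp_pos (- (kappa K * t))). lra.
Qed.

Lemma weighted_norm_ge_0 (K b s t : R) : 0 <= s -> 0 <= t ->
  0 <= s * s + t * t + 2 * s * t * ck K b.
Proof.
  intros Hs Ht. pose proof (ck_ge_m1 K b).
  assert (0 <= s * t) by nra. pose proof (Rle_0_sqr (s - t)) as Q. unfold Rsqr in Q. nra.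
Qed.

(* In the model, the point found here is the normalization of the vector [s P + t Q]. *)
Lemma weighted_point (K : R) {M : Type} (rho : M -> M -> R) (P Q : M) (s t : R) :
  K <> 0 -> RK_domain K rho -> 0 <= s -> 0 <= t ->
  exists m, forall X,
    sgK K * (s * ck K (rho X P) + t * ck K (rho X Q))
    <= sgK K * (sqrt (s * s + t * t + 2 * s * t * ck K (rho P Q)) * ck K (rho X m)).
Proof.
  intros HK HR Hs Ht. pose proof HR as (HM & Hex & _ & _).
  destruct (classic (P = Q)) as [<- | NPQ].
  { exists P. intros X. rewrite (metric_refl rho P HM), ck_0.
    replace (s * s + t * t + 2 * s * t * 1) with ((s + t) * (s + t)) by ring.
    rewrite sqrt_square by lra. right; ring. }
  destruct (Hex P Q) as (S & HS).
  destruct (shortest_isometric rho P Q S HM HS) as (f & If & F0 & Fb & _).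
  pose proof (metric_pos_neq rho P Q HM NPQ) as Pb.
  assert (Rb : 0 < K -> kappa K * rho P Q < PI).
  { intros HK'. pose proof (RK_perimeter K rho P Q P HR HK') as Per.
    destruct HM as (H0 & H1 & Hsym & Htri).
    rewrite (Hsym Q P), (proj2 (H1 P P) eq_refl) in Per. lra. }
  set (b := rho P Q) in *. pose proof (kappa_pos K HK) as Hk.
  assert (Sb : 0 < sk K b) by now apply sk_pos.
  (* At this [p] the weights [sk K (b - p)] and [sk K p] of the cevian inequality are in the ratio
     of [s] to [t]. *)
  destruct (IVT_cor (fun p => t * sk K (b - p) - s * sk K p) 0 b) as (p & Hp & E).
  { intros p. apply continuity_pt_minus.
    - apply continuity_pt_mult; [apply continuity_pt_const; now intros ? ?|].
      apply (continuity_pt_comp (fun p => b - p) (sk K)).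
      + apply continuity_pt_minus; [apply continuity_pt_const; now intros ? ? | apply continuity_pt_id].
      + apply continuity_pt_sk.
    - apply continuity_pt_mult; [apply continuity_pt_const; now intros ? ?|].
      apply continuity_pt_sk. }
  { lra. }
  { rewrite Rminus_0_r, Rminus_diag, sk_0.
    assert (0 <= t * s * (sk K b * sk K b)) by (repeat apply Rmult_le_pos; lra). lra. }
  assert (Snn : forall r, 0 <= r <= b -> 0 <= sk K r).
  { intros r [[Hr | <-] Hr']; [|rewrite sk_0; lra]. left. apply sk_pos; auto.
    intros HK'. specialize (Rb HK'). nra. }
  pose proof (Snn p ltac:(lra)) as Sp. pose proof (Snn (b - p) ltac:(lra)) as Sq.
  (* Formally, [sk K (b - p) P + sk K p Q] has norm [sk K b]; rescaling to the weights [s] and [t]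
     gives [Eq] and [Ep]. *)
  assert (Id : sk K b * sk K b = sk K p * sk K p + sk K (b - p) * sk K (b - p)
     + 2 * (sk K p * sk K (b - p)) * ck K b).
  { assert (Es : sk K b = sk K p * ck K (b - p) + ck K p * sk K (b - p))
      by (rewrite <- sk_plus; f_equal; ring).
    assert (Ec : ck K b = ck K p * ck K (b - p) - sgK K * (sk K p * sk K (b - p)))
      by (rewrite <- ck_plus; f_equal; ring).
    rewrite Es, Ec.
    pose proof (ck_sk_sq K p) as E1. pose proof (ck_sk_sq K (b - p)) as E2.
    set (u := sk K p) in *. set (v := sk K (b - p)) in *.
    set (cu := ck K p) in *. set (cv := ck K (b - p)) in *. set (g := sgK K) in *.
    replace ((u * cv + cu * v) * (u * cv + cu * v))
      with (u * u * (cv * cv) + v * v * (cu * cu) + 2 * (u * v) * (cu * cv)) by ring.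
    replace (cv * cv) with (1 - g * (v * v)) by lra.
    replace (cu * cu) with (1 - g * (u * u)) by lra. ring. }
  pose proof (weighted_norm_ge_0 K b s t Hs Ht) as NN.
  set (N2 := s * s + t * t + 2 * s * t * ck K b) in *.
  assert (Hts : t * sk K (b - p) = s * sk K p) by lra.
  assert (Eq : sqrt N2 * sk K (b - p) = s * sk K b).
  { apply Rsqr_inj; [apply Rmult_le_pos; [apply sqrt_pos | lra] | apply Rmult_le_pos; lra|].
    rewrite Rsqr_mult, Rsqr_sqrt by assumption. unfold Rsqr, N2.
    transitivity (s * s * (sk K b * sk K b)); [rewrite Id | ring].
    transitivity (s * s * (sk K (b - p) * sk K (b - p)) + (t * sk K (b - p)) * (t * sk K (b - p))
      + 2 * s * (t * sk K (b - p)) * sk K (b - p) * ck K b); [ring|].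
    rewrite Hts. ring. }
  assert (Ep : sqrt N2 * sk K p = t * sk K b).
  { apply Rsqr_inj; [apply Rmult_le_pos; [apply sqrt_pos | lra] | apply Rmult_le_pos; lra|].
    rewrite Rsqr_mult, Rsqr_sqrt by assumption. unfold Rsqr, N2.
    transitivity (t * t * (sk K b * sk K b)); [rewrite Id | ring].
    transitivity (t * t * (sk K p * sk K p) + (s * sk K p) * (s * sk K p)
      + 2 * t * (s * sk K p) * sk K p * ck K b); [ring|].
    rewrite <- Hts. ring. }
  exists (f p). intros X.
  pose proof (cevian_comparison K rho X f b p HK HR If Hp) as C. rewrite F0, Fb in C.
  apply (Rmult_le_compat_l (sqrt N2)) in C; [|apply sqrt_pos].
  apply Rmult_le_reg_r with (sk K b); [assumption|].
  replace (sgK K * (s * ck K (rho X P) + t * ck K (rho X Q)) * sk K b)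
    with (sgK K * (ck K (rho X P) * (s * sk K b) + ck K (rho X Q) * (t * sk K b))) by ring.
  rewrite <- Eq, <- Ep. lra.
Qed.

(** This rests on the triangle inequality through [m]: with [c1], [s1], [c2], [s2] as in the proof,
    [(al c1 + be c2)^2 + sgK K (al s1 - be s2)^2] is the expression under the root with
    [rho A m + rho B m] in place of [rho A B]. *)
Lemma weighted_pair (K : R) {M : Type} (rho : M -> M -> R) (A B m : M) (al be : R) :
  K <> 0 -> RK_domain K rho -> 0 <= al -> 0 <= be ->
  sgK K * (al * ck K (rho A m) + be * ck K (rho B m))
  <= sgK K * sqrt (al * al + be * be + 2 * al * be * ck K (rho A B)).
Proof.
  intros HK HR Ha Hb. pose proof (RK_perimeter K rho A m B HR) as Per.
  destruct HR as ((H0 & _ & Hs & Ht) & _).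
  pose proof (Ht A m B) as T. rewrite (Hs m B) in *. rewrite (Hs B A) in Per.
  assert (L : sgK K * ck K (rho A m + rho B m) <= sgK K * ck K (rho A B)).
  { apply sgK_ck_le; auto. intros HK'; specialize (Per HK'); lra. }
  rewrite ck_plus in L.
  pose proof (ck_sk_sq K (rho A m)) as E1. pose proof (ck_sk_sq K (rho B m)) as E2.
  assert (Hck : ~ 0 < K -> 0 <= ck K (rho A m) /\ 0 <= ck K (rho B m)).
  { intros HK'. unfold ck. destruct (Rlt_dec 0 K); [contradiction|]. unfold cosh.
    pose proof (exp_pos (kappa K * rho A m)). pose proof (exp_pos (- (kappa K * rho A m))).
    pose proof (exp_pos (kappa K * rho B m)). pose proof (exp_pos (- (kappa K * rho B m))).
    lra. }
  set (c1 := ck K (rho A m)) in *. set (c2 := ck K (rho B m)) in *.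
  set (s1 := sk K (rho A m)) in *. set (s2 := sk K (rho B m)) in *.
  set (ca := ck K (rho A B)) in *.
  pose proof (Rle_0_sqr (al * s1 - be * s2)) as Q. unfold Rsqr in Q.
  assert (Hab : 0 <= al * be) by nra.
  unfold sgK in *. destruct (Rlt_dec 0 K).
  - rewrite !Rmult_1_l. eapply Rle_trans; [apply Rle_abs|]. rewrite <- sqrt_Rsqr_abs.
    apply sqrt_le_1_alt. unfold Rsqr.
    assert (al * be * (c1 * c2 - 1 * (s1 * s2)) <= al * be * ca)
      by (apply Rmult_le_compat_l; lra).
    replace ((al * c1 + be * c2) * (al * c1 + be * c2)) with
     (al * al * (c1 * c1) + be * be * (c2 * c2) + 2 * (al * be * (c1 * c2))) by ring.
    replace (c1 * c1) with (1 - s1 * s1) by lra. replace (c2 * c2) with (1 - s2 * s2) by lra.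
    lra.
  - destruct (Hck n) as [P1 P2].
    assert (sqrt (al * al + be * be + 2 * al * be * ca) <= al * c1 + be * c2); [|lra].
    rewrite <- (sqrt_square (al * c1 + be * c2)) by nra.
    apply sqrt_le_1_alt.
    assert (al * be * ca <= al * be * (c1 * c2 - -1 * (s1 * s2)))
      by (apply Rmult_le_compat_l; lra).
    replace ((al * c1 + be * c2) * (al * c1 + be * c2)) with
     (al * al * (c1 * c1) + be * be * (c2 * c2) + 2 * (al * be * (c1 * c2))) by ring.
    replace (c1 * c1) with (1 + s1 * s1) by lra. replace (c2 * c2) with (1 + s2 * s2) by lra.
    lra.
Qed.

(* Cauchy-Schwarz (reversed for [K < 0]) for the vectors [s P + t Q] and [al A + be B]. *)
Lemma four_point_cauchy_schwarz (K : R) {M : Type} (rho : M -> M -> R) (P Q A B : M)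
    (s t al be : R) :
  K <> 0 -> RK_domain K rho -> 0 <= s -> 0 <= t -> 0 <= al -> 0 <= be ->
  sgK K * (al * (s * ck K (rho A P) + t * ck K (rho A Q))
           + be * (s * ck K (rho B P) + t * ck K (rho B Q)))
  <= sgK K * (sqrt (s * s + t * t + 2 * s * t * ck K (rho P Q))
              * sqrt (al * al + be * be + 2 * al * be * ck K (rho A B))).
Proof.
  intros HK HR Hs Ht Ha Hb.
  destruct (weighted_point K rho P Q s t HK HR Hs Ht) as (m & Hm).
  pose proof (Rmult_le_compat_l al _ _ Ha (Hm A)) as L1.
  pose proof (Rmult_le_compat_l be _ _ Hb (Hm B)) as L2.
  pose proof (Rmult_le_compat_l _ _ _ (sqrt_pos (s * s + t * t + 2 * s * t * ck K (rho P Q)))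
    (weighted_pair K rho A B m al be HK HR Ha Hb)) as L3.
  lra.
Qed.

(** * From the four-point inequality to [cosq] *)

(** This is [-1 <= cosq]. The weights [sy] and [sx] of [P] and [Q] give the unit directions of [AP]
    and [BQ] the common factor [sx * sy]. The squared norms become [de^2 + E] and
    [(m - 1/m)^2 + 2 (1 + ca)]; the product [de * et] cancels against the same term in the pairing,
    and AM-GM for [al * v + m * u] finishes. *)
Lemma spherical_lower (cx sx cy sy ca cb cd cf : R) :
  0 < sx -> 0 < sy -> cx * cx + sx * sx = 1 -> cy * cy + sy * sy = 1 ->
  0 <= cx -> 0 <= cy -> 0 <= ca -> 0 <= cb -> 0 <= cd -> 0 <= cf ->
  (forall s t al be, 0 <= s -> 0 <= t -> 0 <= al -> 0 <= be ->
    al * (s * cx + t * cf) + be * (s * cd + t * cy)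
    <= sqrt (s * s + t * t + 2 * s * t * cb) * sqrt (al * al + be * be + 2 * al * be * ca)) ->
  (cx + cd) * (cy + cf) <= (1 + ca) * (cb + cx * cy + sx * sy).
Proof.
  intros Hsx Hsy Ex Ey Hx Hy Ha Hb Hd Hf H.
  set (de := sx * cy - cx * sy).
  set (E := 2 * (sx * sy) * (cb + cx * cy + sx * sy)).
  assert (Psxy : 0 < sx * sy) by nra. assert (0 <= cx * cy) by nra.
  assert (HE : 0 < E) by (unfold E; apply Rmult_lt_0_compat; lra).
  set (r := sqrt (2 * (1 + ca) / E)).
  assert (Pr : 0 < 2 * (1 + ca) / E) by (apply Rdiv_lt_0_compat; lra).
  assert (Hr : 0 < r) by now apply sqrt_lt_R0.
  assert (Er : r * r * E = 2 * (1 + ca)).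
  { unfold r. rewrite sqrt_sqrt by lra. field. lra. }
  (* this [m] gives equality in the Cauchy-Schwarz step, so that only AM-GM is lossy *)
  set (et := de * r). set (m := (et + sqrt (et * et + 4)) / 2).
  assert (Hsq : sqrt (et * et + 4) * sqrt (et * et + 4) = et * et + 4) by (apply sqrt_sqrt; nra).
  assert (Hm : 0 < m).
  { assert (Rabs et < sqrt (et * et + 4)).
    { rewrite <- sqrt_Rsqr_abs. apply sqrt_lt_1_alt. unfold Rsqr. nra. }
    pose proof (Rle_abs (- et)). rewrite Rabs_Ropp in *. unfold m. lra. }
  assert (Em : m - / m = et).
  { apply Rmult_eq_reg_r with m; [|lra]. rewrite Rmult_minus_distr_r, Rinv_l by lra.
    unfold m. set (q := sqrt (et * et + 4)) in *. nra. }
  assert (Pm : 0 < / m) by now apply Rinv_0_lt_compat.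
  assert (Emm : / m * m = 1) by (apply Rinv_l; lra).
  specialize (H sy sx (/ m) m ltac:(lra) ltac:(lra) ltac:(lra) ltac:(lra)).
  set (al := / m) in *. clearbody al.
  assert (N1 : sy * sy + sx * sx + 2 * sy * sx * cb = de * de + E).
  { unfold de, E.
    replace (sy * sy + sx * sx) with
      (sy * sy * (cx * cx + sx * sx) + sx * sx * (cy * cy + sy * sy)) by (rewrite Ex, Ey; ring).
    ring. }
  assert (N2 : al * al + m * m + 2 * al * m * ca = r * r * (de * de + E)).
  { transitivity (et * et + 2 * (1 + ca)); [|rewrite <- Er; unfold et; ring].
    rewrite <- Em. replace ((m - al) * (m - al)) with (m * m + al * al - 2 * (al * m)) by ring.
    replace (2 * al * m * ca) with (2 * (al * m) * ca) by ring. rewrite Emm. ring. }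
  rewrite N1, N2, <- sqrt_mult_alt in H by nra.
  replace ((de * de + E) * (r * r * (de * de + E))) with
    ((r * (de * de + E)) * (r * (de * de + E))) in H by ring.
  rewrite sqrt_square in H by (apply Rmult_le_pos; nra).
  set (v := sx * (cy + cf)). set (u := sy * (cx + cd)).
  assert (L : al * v + m * u <= r * E).
  { replace (al * v + m * u) with
      (al * (sy * cx + sx * cf) + m * (sy * cd + sx * cy) - (m - al) * de)
      by (unfold u, v, de; ring).
    rewrite Em. unfold et. lra. }
  assert (Pu : 0 <= u) by (unfold u; nra). assert (Pv : 0 <= v) by (unfold v; nra).
  assert (L2 : 4 * (u * v) <= r * E * (r * E)).
  { apply Rle_trans with ((al * v + m * u) * (al * v + m * u)).
    - pose proof (Rle_0_sqr (al * v - m * u)) as Q. unfold Rsqr in Q.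
      replace (4 * (u * v)) with (4 * (u * v) * (al * m)) by (rewrite Emm; ring). lra.
    - assert (0 <= al * v + m * u) by nra. nra. }
  replace (r * E * (r * E)) with (r * r * E * E) in L2 by ring. rewrite Er in L2.
  apply Rmult_le_reg_l with (4 * (sx * sy)); [lra|].
  unfold u, v, E in L2. lra.
Qed.

(* The weights are multiples of the coefficients of [T u - v], [u - T^-1 v] and [u - v], where
   [u], [v] are the unit directions of [AP], [BQ] and [T] is the parallel transport along [AB];
   the first two have squared norm [2 - 2 cosq], and [u - v] at most that when both base angles
   are acute. *)
Lemma spherical_upper (cx sx cy sy ca cb cd cf : R) :
  0 < sx -> 0 < sy -> cx * cx + sx * sx = 1 -> cy * cy + sy * sy = 1 ->
  0 <= cx -> 0 <= cy -> 0 <= ca -> 0 <= cb -> 0 <= cd -> 0 <= cf ->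
  (forall s t al be, 0 <= s -> 0 <= t -> 0 <= al -> 0 <= be ->
    2 * (al * (s * cx + t * cb) + be * (s * ca + t * cy))
    <= (s * s + t * t + 2 * s * t * cf) + (al * al + be * be + 2 * al * be * cd)) ->
  (1 + ca) * (cb + cx * cy - sx * sy) <= (cx + cd) * (cy + cf).
Proof.
  intros Hsx Hsy Ex Ey Hx Hy Ha Hb Hd Hf H.
  assert (Psxy : 0 < sx * sy) by nra.
  (* The signs of [cd - cx * ca] and [cf - cy * ca] are those of the cosines of the base angles at
     [A] and [B]. A nonpositive one makes the weight with a minus sign nonnegative; if both are
     positive, their product is exactly the loss incurred by using the untransported difference. *)
  destruct (Rle_dec cd (cx * ca)) as [H1 | H1]; [|destruct (Rle_dec cf (cy * ca)) as [H2 | H2]].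
  - assert (P1 : 0 <= sx * (1 + ca) * cy) by (repeat apply Rmult_le_pos; lra).
    assert (P2 : 0 <= sy * (cx * ca - cd)) by (apply Rmult_le_pos; lra).
    specialize (H (sy * (cx + cd)) (sx * (1 + ca)) (sy * (1 + ca))
      (sx * (1 + ca) * cy - sy * (cd - cx * ca))
      ltac:(nra) ltac:(nra) ltac:(nra) ltac:(lra)).
    apply Rmult_le_reg_l with (2 * (sx * sy) * (1 + ca)); [nra|].
    match type of H with ?l <= ?r => assert (Id : r - l = 2 * (sx * sy) * (1 + ca) *
      ((cx + cd) * (cy + cf) - (1 + ca) * (cb + cx * cy - sx * sy)))
      by (clear - Ex Ey; nsatz) end. lra.
  - assert (P1 : 0 <= sy * (1 + ca) * cx) by (repeat apply Rmult_le_pos; lra).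
    assert (P2 : 0 <= sx * (cy * ca - cf)) by (apply Rmult_le_pos; lra).
    specialize (H (sy * (1 + ca) * cx - sx * (cf - cy * ca)) (sx * (1 + ca)) (sy * (1 + ca))
      (sx * (cy + cf)) ltac:(lra) ltac:(nra) ltac:(nra) ltac:(nra)).
    apply Rmult_le_reg_l with (2 * (sx * sy) * (1 + ca)); [nra|].
    match type of H with ?l <= ?r => assert (Id : r - l = 2 * (sx * sy) * (1 + ca) *
      ((cx + cd) * (cy + cf) - (1 + ca) * (cb + cx * cy - sx * sy)))
      by (clear - Ex Ey; nsatz) end. lra.
  - specialize (H (cx * sy) sx sy (cy * sx) ltac:(nra) ltac:(lra) ltac:(lra) ltac:(nra)).
    match type of H with ?l <= ?r => assert (Id : r - l = 2 * (sx * sy) *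
      (sx * sy - (cb - cx * cf - cy * cd + cx * cy * ca)))
      by (clear - Ex Ey; nsatz) end.
    assert (P1 : 0 <= sx * sy - (cb - cx * cf - cy * cd + cx * cy * ca)) by nra.
    assert (P2 : 0 <= (cd - cx * ca) * (cf - cy * ca)) by (apply Rmult_le_pos; lra).
    assert (P3 : 0 <= (1 + ca) * (sx * sy - (cb - cx * cf - cy * cd + cx * cy * ca)))
      by (apply Rmult_le_pos; lra).
    lra.
Qed.

(** Compared with positive curvature the roles are swapped: the weights [u] and [v] give equality in
    AM-GM, and the lossy step is [CS], which bounds the product of norms from below, as a reversed
    inequality demands. *)
Lemma hyperbolic_lower (cx sx cy sy ca cb cd cf : R) :
  0 < sx -> 0 < sy -> cx * cx = 1 + sx * sx -> cy * cy = 1 + sy * sy ->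
  1 <= cx -> 1 <= cy -> 1 <= ca -> 1 <= cb -> 1 <= cd -> 1 <= cf ->
  (forall s t al be, 0 <= s -> 0 <= t -> 0 <= al -> 0 <= be ->
    sqrt (s * s + t * t + 2 * s * t * cb) * sqrt (al * al + be * be + 2 * al * be * ca)
    <= al * (s * cx + t * cf) + be * (s * cd + t * cy)) ->
  (1 + ca) * (cb + cx * cy - sx * sy) <= (cx + cd) * (cy + cf).
Proof.
  intros Hsx Hsy Ex Ey Hx Hy Ha Hb Hd Hf H.
  set (de := sx * cy - cx * sy).
  set (E := 2 * (sx * sy) * (cb + cx * cy - sx * sy)).
  assert (Psxy : 0 < sx * sy) by nra.
  assert (Lx : sx <= cx) by nra. assert (Ly : sy <= cy) by nra.
  assert (Hcc : sx * sy <= cx * cy) by (apply Rmult_le_compat; lra).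
  assert (HE : 0 < E) by (unfold E; apply Rmult_lt_0_compat; lra).
  set (v := sx * (cy + cf)). set (u := sy * (cx + cd)).
  assert (Pu : 0 < u) by (unfold u; nra). assert (Pv : 0 < v) by (unfold v; nra).
  assert (Puv : 0 < u * v) by nra.
  specialize (H sy sx u v ltac:(lra) ltac:(lra) ltac:(lra) ltac:(lra)).
  set (T := 2 * (1 + ca) * (u * v)). assert (HT : 0 < T) by (unfold T; nra).
  replace (sy * sy + sx * sx + 2 * sy * sx * cb) with (de * de + E) in H.
  2:{ unfold de, E. replace (sy * sy + sx * sx) with
        (sy * sy * (cx * cx - sx * sx) + sx * sx * (cy * cy - sy * sy)) by (rewrite Ex, Ey; ring).
      ring. }
  replace (u * u + v * v + 2 * u * v * ca) with ((u - v) * (u - v) + T) in H by (unfold T; ring).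
  replace (u * (sy * cx + sx * cf) + v * (sy * cd + sx * cy))
    with (2 * (u * v) - (u - v) * de) in H by (unfold u, v, de; ring).
  set (w := u - v) in *.
  rewrite <- sqrt_mult_alt in H by nra.
  pose proof (sqrt_sqrt E ltac:(lra)) as SE. pose proof (sqrt_sqrt T ltac:(lra)) as ST.
  set (e1 := sqrt E) in *. set (t1 := sqrt T) in *.
  assert (CS : e1 * t1 - w * de <= sqrt ((de * de + E) * (w * w + T))).
  { eapply Rle_trans; [apply Rle_abs|]. rewrite <- sqrt_Rsqr_abs. apply sqrt_le_1_alt.
    rewrite <- SE, <- ST. unfold Rsqr.
    pose proof (Rle_0_sqr (de * t1 + w * e1)) as Q. unfold Rsqr in Q. lra. }
  assert (L : e1 * t1 <= 2 * (u * v)) by lra.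
  assert (P : 0 <= e1 * t1) by (apply Rmult_le_pos; apply sqrt_pos).
  assert (L2 : E * T <= 2 * (u * v) * (2 * (u * v))).
  { rewrite <- SE, <- ST. replace (e1 * e1 * (t1 * t1)) with (e1 * t1 * (e1 * t1)) by ring. nra. }
  apply Rmult_le_reg_l with (4 * (sx * sy) * (u * v)); [nra|].
  unfold E, T in L2.
  replace (4 * (sx * sy) * (u * v) * ((cx + cd) * (cy + cf)))
    with (2 * (u * v) * (2 * (u * v))) by (unfold u, v; ring).
  lra.
Qed.

(* [m] and [n] are the weights of [A] and [B], those of [P] and [Q] being [1]. *)
Lemma hyperbolic_upper_small (cx sx cy sy F D c H : R) :
  0 < sx -> 0 < sy -> cx * cx = 1 + sx * sx -> cy * cy = 1 + sy * sy -> 0 < cx -> 0 < cy ->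
  0 < F -> 0 < D -> 0 < c -> 0 < H ->
  (forall m n, 0 < m -> 0 < n -> c * (m * n) = H ->
    (m * m - 2 * m * cy + 1 + 2 * m * F) * (n * n - 2 * n * cx + 1 + 2 * n * D)
      <= Rsqr (2 * H - (m - cy) * (n - cx) - sx * sy)
    /\ 0 <= 2 * H - (m - cy) * (n - cx) - sx * sy) ->
  H <= c * ((cy + sy) * (cx - sx)) -> F * D <= c * H.
Proof.
  intros Hsx Hsy Ex Ey Hcx Hcy HF HD Hc HH Hall Hk.
  assert (Lx : sx < cx) by nra.
  (* On the line [m = cy + z * sy], [n = cx - z * sx] the two quadratics are [z^2 - 1] times [sy^2]
     and [sx^2]. Both are nonnegative for [z >= 1], so Cauchy-Schwarz bounds the product of the two
     factors from below. *)
  destruct (IVT_cor (fun z => c * ((cy + z * sy) * (cx - z * sx)) - H) 1 (cx / sx)) as (z & Hz & Ez).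
  - intros z. reg.
  - apply Rle_div_r; lra.
  - replace (cx - cx / sx * sx) with 0 by (field; lra). rewrite !Rmult_1_l. nra.
  - set (m := cy + z * sy) in *. set (n := cx - z * sx) in *.
    assert (Hm : 0 < m) by (unfold m; nra).
    assert (Hn : 0 < n).
    { apply Rnot_le_lt. intros Hn. assert (c * (m * n) <= 0); [|lra].
      assert (m * n <= 0) by nra. nra. }
    destruct (Hall m n Hm Hn ltac:(lra)) as [L1 L2].
    set (j := z * z - 1). assert (Hj : 0 <= j) by (unfold j; nra).
    replace (m * m - 2 * m * cy + 1) with (j * (sy * sy)) in L1
      by (unfold m, j; nra).
    replace (n * n - 2 * n * cx + 1) with (j * (sx * sx)) in L1
      by (unfold n, j; nra).
    replace (2 * H - (m - cy) * (n - cx) - sx * sy) with (2 * H + j * (sx * sy)) in L1, L2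
      by (unfold m, n, j; ring).
    set (p := sqrt (m * F)). set (q := sqrt (n * D)).
    assert (Ep : p * p = m * F) by (apply sqrt_sqrt; nra).
    assert (Eq : q * q = n * D) by (apply sqrt_sqrt; nra).
    assert (Pp : 0 <= p) by apply sqrt_pos. assert (Pq : 0 <= q) by apply sqrt_pos.
    assert (L3 : Rsqr (j * (sx * sy) + 2 * (p * q)) <= Rsqr (2 * H + j * (sx * sy))).
    { eapply Rle_trans; [|exact L1]. unfold Rsqr.
      replace (2 * m * F) with (2 * (p * p)) by (rewrite Ep; ring).
      replace (2 * n * D) with (2 * (q * q)) by (rewrite Eq; ring).
      assert (0 <= j * ((sy * q - sx * p) * (sy * q - sx * p))).
      { apply Rmult_le_pos; [assumption|]. apply Rle_0_sqr. }
      lra. }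
    assert (Ppq : 0 <= p * q) by nra.
    assert (0 <= j * (sx * sy)) by (apply Rmult_le_pos; nra).
    apply Rsqr_incr_0 in L3; [|lra|lra].
    assert (L4 : p * q <= H) by lra.
    assert (L5 : m * F * (n * D) <= H * H).
    { rewrite <- Ep, <- Eq. replace (p * p * (q * q)) with (p * q * (p * q)) by ring. nra. }
    assert (Pmn : 0 < m * n) by nra.
    apply Rmult_le_reg_l with (m * n); [assumption|].
    replace (m * n * (c * H)) with (c * (m * n) * H) by ring.
    replace (c * (m * n)) with H by lra. lra.
Qed.

(** The quadratics factor as [(m - ey) (m - 1/ey)] and [(n - ex) (n - 1/ex)], where [ex] and [ey]
    are in the application the exponentials of the scaled sides. The prescribed product [k = m * n]
    decides how to choose [m]: for [k] up to [ey / ex] or [ex / ey], or from [ex * ey] on, both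
    quadratics can be made nonnegative; in the remaining range both are made nonpositive and have to
    be balanced. *)
Lemma hyperbolic_upper_core (cx sx cy sy F D c H : R) :
  0 < sx -> 0 < sy -> cx * cx = 1 + sx * sx -> cy * cy = 1 + sy * sy -> 0 < cx -> 0 < cy ->
  0 < F -> 0 < D -> 0 < c -> 0 < H ->
  (forall m n, 0 < m -> 0 < n -> c * (m * n) = H ->
    (m * m - 2 * m * cy + 1 + 2 * m * F) * (n * n - 2 * n * cx + 1 + 2 * n * D)
      <= Rsqr (2 * H - (m - cy) * (n - cx) - sx * sy)
    /\ 0 <= 2 * H - (m - cy) * (n - cx) - sx * sy) ->
  F * D <= c * H.
Proof.
  intros Hsx Hsy Ex Ey Hcx Hcy HF HD Hc HH Hall.
  assert (Lx : sx < cx) by nra. assert (Ly : sy < cy) by nra.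
  set (ex := cx + sx). set (ey := cy + sy).
  assert (Iex : ex * (cx - sx) = 1) by (unfold ex; lra).
  assert (Iey : ey * (cy - sy) = 1) by (unfold ey; lra).
  assert (Pex : 0 < ex) by (unfold ex; lra). assert (Pey : 0 < ey) by (unfold ey; lra).
  set (k := H / c). assert (Pk : 0 < k) by (now apply Rdiv_lt_0_compat).
  assert (Ek : c * k = H) by (unfold k; field; lra).
  destruct (Rle_dec H (c * (ey * (cx - sx)))) as [C1 | C1].
  { now apply (hyperbolic_upper_small cx sx cy sy). }
  destruct (Rle_dec H (c * (ex * (cy - sy)))) as [C2 | C2].
  { rewrite Rmult_comm. apply (hyperbolic_upper_small cy sy cx sx); auto.
    intros m n Hm Hn E. destruct (Hall n m Hn Hm) as [A1 A2]; [lra|].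
    replace (2 * H - (m - cx) * (n - cy) - sy * sx)
      with (2 * H - (n - cy) * (m - cx) - sx * sy) by ring.
    split; [|exact A2]. rewrite Rmult_comm. exact A1. }
  apply Rnot_le_lt in C1. apply Rnot_le_lt in C2.
  assert (K1 : ey * (cx - sx) < k) by nra. assert (K2 : ex * (cy - sy) < k) by nra.
  clear C1 C2.
  destruct (Rle_dec (ex * ey) k) as [C3 | C3].
  (* The choice [m = ey] annihilates the first quadratic, and then [n >= ex] makes the second
     nonnegative. *)
  { assert (Hn : ex <= k / ey) by (apply Rle_div_r; lra).
    destruct (Hall ey (k / ey)) as [A1 A2]; [assumption | lra | |].
    { rewrite <- Ek. field. lra. }
    set (n := k / ey) in *. assert (Enk : ey * n = k) by (unfold n; field; lra).
    replace (ey * ey - 2 * ey * cy + 1) with 0 in A1 by (unfold ey; nra).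
    replace (ey - cy) with sy in A1, A2 by (unfold ey; ring).
    assert (P1 : 0 <= n * n - 2 * n * cx + 1).
    { replace (n * n - 2 * n * cx + 1) with ((n - ex) * (n - (cx - sx))) by (unfold ex; nra).
      unfold ex in *. nra. }
    assert (P2 : 0 <= sy * (n - cx)) by (apply Rmult_le_pos; unfold ex in *; lra).
    assert (L : Rsqr (2 * H - sy * (n - cx) - sx * sy) <= Rsqr (2 * H)).
    { apply Rsqr_incr_1; nra. }
    unfold Rsqr in *.
    assert (L2 : 2 * ey * F * (2 * n * D) <= 2 * H * (2 * H)).
    { assert (0 < 2 * ey * F) by (repeat apply Rmult_lt_0_compat; lra). nra. }
    replace (2 * ey * F * (2 * n * D)) with (4 * (ey * n) * (F * D)) in L2 by ring.
    rewrite Enk in L2.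
    apply Rmult_le_reg_l with k; [assumption|].
    replace (k * (c * H)) with (c * k * H) by ring. rewrite Ek. lra. }
  apply Rnot_le_lt in C3.
  assert (Hlt : k / ex < ey) by (apply Rlt_div_l; lra).
  assert (Hgt : 0 < k / ex) by (now apply Rdiv_lt_0_compat).
  (* With [n = k / m], this is [m * (F * m * Y' - D * n * X')] cleared of denominators. At [m = ey]
     the term [X'] vanishes, at [m = k / ex] the term [Y'], which gives the opposite signs. *)
  set (g := fun m => F * (2 * k * cx * m - m * m - k * k) - D * k * (2 * m * cy - 1 - m * m)).
  (* At the root of [g] both factors stand in the same ratio to their negative parts [X'], [Y'],
     which is the equality case of the reversed Cauchy-Schwarz inequality. *)
  destruct (IVT_cor g (k / ex) ey) as (m & Hm & Egm).
  { intros m. unfold g. reg. }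
  { lra. }
  { assert (G1 : g ey = F * ((ey * ex - k) * (k - ey * (cx - sx)))).
    { unfold g. replace (2 * ey * cy - 1 - ey * ey) with 0 by (unfold ey; lra).
      replace (2 * k * cx * ey - ey * ey - k * k) with
        (2 * k * cx * ey - ey * ey * (ex * (cx - sx)) - k * k) by (rewrite Iex; ring).
      unfold ex; ring. }
    set (m2 := k / ex) in *. assert (Em2 : k = ex * m2) by (unfold m2; field; lra).
    assert (G2 : g m2 = - (D * k * ((ey - m2) * (m2 - (cy - sy))))).
    { assert (Q : 2 * k * cx * m2 - m2 * m2 - k * k = 0).
      { rewrite Em2. replace (2 * (ex * m2) * cx * m2 - m2 * m2 - ex * m2 * (ex * m2))
          with (m2 * m2 * (ex * (2 * cx - ex) - 1)) by ring.
        replace (2 * cx - ex) with (cx - sx) by (unfold ex; ring). rewrite Iex. ring. }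
      unfold g. rewrite Q.
      replace (2 * m2 * cy - 1 - m2 * m2) with ((ey - m2) * (m2 - (cy - sy)))
        by (unfold ey in *; lra).
      ring. }
    assert (cy - sy < m2) by (apply Rmult_lt_reg_l with ex; lra).
    assert (0 <= g ey) by (rewrite G1; apply Rmult_le_pos; [lra|]; apply Rmult_le_pos; lra).
    assert (0 <= D * k * ((ey - m2) * (m2 - (cy - sy))))
      by (apply Rmult_le_pos; [apply Rmult_le_pos | apply Rmult_le_pos]; lra).
    assert (g m2 <= 0) by lra.
    nra. }
  assert (Pm : 0 < m) by lra.
  set (n := k / m). assert (Enk : m * n = k) by (unfold n; field; lra).
  assert (Pn : 0 < n) by (now apply Rdiv_lt_0_compat).
  destruct (Hall m n Pm Pn ltac:(rewrite Enk; exact Ek)) as [A1 A2].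
  assert (M1 : cy - sy <= m).
  { apply Rle_trans with (k / ex); [|lra]. apply Rle_div_r; lra. }
  assert (M2 : m <= ey) by lra.
  assert (M3 : cx - sx <= n).
  { apply Rle_div_r; [assumption|]. apply Rle_trans with ((cx - sx) * ey); [|lra].
    apply Rmult_le_compat_l; lra. }
  assert (M4 : n <= ex).
  { apply Rle_div_l; [assumption|]. destruct Hm as [Hm1 _].
    apply Rle_div_l in Hm1; lra. }
  set (X' := 2 * m * cy - 1 - m * m). set (Y' := 2 * n * cx - 1 - n * n).
  set (p := m - cy) in *. set (q := n - cx) in *.
  assert (EX : X' = sy * sy - p * p) by (unfold X', p; lra).
  assert (EY : Y' = sx * sx - q * q) by (unfold Y', q; lra).
  assert (Bp : - sy <= p <= sy) by (unfold p, ey in *; lra).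
  assert (Bq : - sx <= q <= sx) by (unfold q, ex in *; lra).
  assert (PX : 0 <= X') by (rewrite EX; nra).
  assert (PY : 0 <= Y') by (rewrite EY; nra).
  assert (Tie : F * m * Y' = D * n * X').
  { apply Rmult_eq_reg_l with m; [|lra].
    replace (m * (D * n * X')) with (D * (m * n) * X') by ring.
    replace (m * (F * m * Y')) with (F * (2 * (m * n) * cx * m - m * m - m * n * (m * n)))
      by (unfold Y'; ring).
    rewrite Enk. unfold g in Egm. fold X' in Egm. lra. }
  replace (m * m - 2 * m * cy + 1 + 2 * m * F) with (2 * m * F - X') in A1 by (unfold X'; ring).
  replace (n * n - 2 * n * cx + 1 + 2 * n * D) with (2 * n * D - Y') in A1 by (unfold Y'; ring).
  set (w := sqrt (4 * k * (F * D))). set (j := sqrt (X' * Y')).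
  assert (PFD : 0 < F * D) by nra.
  assert (Ew : w * w = 4 * k * (F * D)) by (apply sqrt_sqrt; nra).
  assert (Ej : j * j = X' * Y') by (apply sqrt_sqrt; nra).
  assert (Pw : 0 <= w) by apply sqrt_pos. assert (Pj : 0 <= j) by apply sqrt_pos.
  assert (Ewj : w * j = 2 * (F * m * Y')).
  { apply Rsqr_inj; [nra | repeat apply Rmult_le_pos; lra |]. unfold Rsqr.
    replace (w * j * (w * j)) with (w * w * (j * j)) by ring. rewrite Ew, Ej.
    replace (2 * (F * m * Y') * (2 * (F * m * Y')))
      with (4 * (F * m * Y') * (F * m * Y')) by ring.
    rewrite Tie at 2. rewrite <- Enk. ring. }
  assert (A3 : Rsqr (w - j) <= Rsqr (2 * H - p * q - sx * sy)).
  { eapply Rle_trans; [|exact A1]. right. unfold Rsqr.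
    replace ((w - j) * (w - j)) with (w * w + j * j - 2 * (w * j)) by ring.
    replace ((2 * m * F - X') * (2 * n * D - Y'))
      with (4 * (m * n) * (F * D) + X' * Y' - 2 * (F * m * Y') - 2 * (D * n * X')) by ring.
    rewrite <- Tie, Enk, Ew, Ej, Ewj. ring. }
  assert (A4 : w - j <= 2 * H - p * q - sx * sy).
  { apply Rsqr_le_abs_0 in A3. rewrite (Rabs_right (2 * H - p * q - sx * sy)) in A3 by lra.
    pose proof (Rle_abs (w - j)). lra. }
  assert (A5 : j <= p * q + sx * sy).
  { assert (0 <= p * q + sx * sy) by nra.
    apply Rsqr_incr_0; [|assumption|assumption]. unfold Rsqr. rewrite Ej, EX, EY.
    pose proof (Rle_0_sqr (p * sx + q * sy)) as Q. unfold Rsqr in Q. lra. }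
  assert (A6 : w * w <= 2 * H * (2 * H)) by (apply Rmult_le_compat; lra).
  rewrite Ew in A6.
  apply Rmult_le_reg_l with k; [assumption|].
  replace (k * (c * H)) with (c * k * H) by ring. rewrite Ek. lra.
Qed.

(** Splitting off [2 m (cy + cf)] and [2 n (cx + cd)] from the squared norms isolates the two
    factors of the claim. The normalization [(1 + ca) m n = H] turns the pairing into [2 * H] minus
    terms without [ca] and [cb]. *)
Lemma hyperbolic_upper (cx sx cy sy ca cb cd cf : R) :
  0 < sx -> 0 < sy -> cx * cx = 1 + sx * sx -> cy * cy = 1 + sy * sy ->
  1 <= cx -> 1 <= cy -> 1 <= ca -> 1 <= cb -> 1 <= cd -> 1 <= cf ->
  (forall s t al be, 0 <= s -> 0 <= t -> 0 <= al -> 0 <= be ->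
    sqrt (s * s + t * t + 2 * s * t * cf) * sqrt (al * al + be * be + 2 * al * be * cd)
    <= al * (s * cx + t * cb) + be * (s * ca + t * cy)) ->
  (cx + cd) * (cy + cf) <= (1 + ca) * (cb + cx * cy + sx * sy).
Proof.
  intros Hsx Hsy Ex Ey Hx Hy Ha Hb Hd Hf H.
  rewrite (Rmult_comm (cx + cd)).
  assert (0 < cx * cy) by nra. assert (0 < sx * sy) by nra.
  apply (hyperbolic_upper_core cx sx cy sy); auto; try lra.
  intros m n Hm Hn E.
  specialize (H m 1 1 n ltac:(lra) ltac:(lra) ltac:(lra) ltac:(lra)).
  replace (m * m + 1 * 1 + 2 * m * 1 * cf)
    with (m * m - 2 * m * cy + 1 + 2 * m * (cy + cf)) in H by ring.
  replace (1 * 1 + n * n + 2 * 1 * n * cd)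
    with (n * n - 2 * n * cx + 1 + 2 * n * (cx + cd)) in H by ring.
  replace (1 * (m * cx + 1 * cb) + n * (m * ca + 1 * cy))
    with (2 * (cb + cx * cy + sx * sy) - (m - cy) * (n - cx) - sx * sy) in H by lra.
  assert (P1 : 0 <= m * m - 2 * m * cy + 1 + 2 * m * (cy + cf)) by nra.
  assert (P2 : 0 <= n * n - 2 * n * cx + 1 + 2 * n * (cx + cd)) by nra.
  set (N1 := m * m - 2 * m * cy + 1 + 2 * m * (cy + cf)) in *.
  set (N2 := n * n - 2 * n * cx + 1 + 2 * n * (cx + cd)) in *.
  set (W := 2 * (cb + cx * cy + sx * sy) - (m - cy) * (n - cx) - sx * sy) in *.
  assert (P3 : 0 <= sqrt N1 * sqrt N2) by (apply Rmult_le_pos; apply sqrt_pos).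
  split; [|lra].
  rewrite <- (sqrt_sqrt N1), <- (sqrt_sqrt N2) by assumption.
  replace (sqrt N1 * sqrt N1 * (sqrt N2 * sqrt N2)) with (Rsqr (sqrt N1 * sqrt N2))
    by (unfold Rsqr; ring).
  apply Rsqr_incr_1; lra.
Qed.

(** * The bound on [cosq] for both signs of curvature *)

Lemma cosq_ck (K : R) {M : Type} (rho : M -> M -> R) (A P B Q : M) :
  cosq rho K A P B Q =
  sgK K * ((ck K (rho P Q) + ck K (rho A P) * ck K (rho B Q)) / (sk K (rho A P) * sk K (rho B Q))
    - (ck K (rho A P) + ck K (rho P B)) * (ck K (rho B Q) + ck K (rho A Q))
        / ((1 + ck K (rho A B)) * sk K (rho A P) * sk K (rho B Q))).
Proof. unfold cosq, sgK, ck, sk. cbv zeta. destruct (Rlt_dec 0 K); ring. Qed.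

Lemma ck_ge_1 (K t : R) : K < 0 -> 0 <= t -> 1 <= ck K t.
Proof.
  intros HK Ht. pose proof (kappa_pos K ltac:(lra)).
  unfold ck; destruct (Rlt_dec 0 K); [lra|]. rewrite <- cosh_0. apply cosh_le; nra.
Qed.

Lemma sqrt_mult_le_half_sum (u v : R) : 0 <= u -> 0 <= v -> 2 * (sqrt u * sqrt v) <= u + v.
Proof.
  intros Hu Hv. rewrite <- (sqrt_sqrt u) at 2 by assumption.
  rewrite <- (sqrt_sqrt v) at 2 by assumption.
  pose proof (Rle_0_sqr (sqrt u - sqrt v)) as Q. unfold Rsqr in Q. lra.
Qed.

Theorem theorem4p1 (K : R) (M : Type) (rho : M -> M -> R) (A P B Q : M) :
  K <> 0 ->
  RK_domain K rho ->
  A <> P -> B <> Q ->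
  (0 < K -> diam4_le rho A P B Q (PI / (2 * sqrt K))) ->
  Rabs (cosq rho K A P B Q) <= 1.
Proof.
  intros HK HR HAP HBQ Hdiam.
  pose proof HR as (HM & _). pose proof HM as (H0 & _ & Hs & _).
  pose proof (metric_pos_neq rho A P HM HAP) as Px.
  pose proof (metric_pos_neq rho B Q HM HBQ) as Py.
  assert (rng : forall X Y : M, 0 < rho X Y -> 0 < sk K (rho X Y)).
  { intros X Y HXY. apply sk_pos; auto. intros HK'.
    pose proof (RK_perimeter K rho X Y X HR HK') as Per.
    rewrite (Hs Y X), (metric_refl rho X HM) in Per. lra. }
  pose proof (rng A P Px) as Sx. pose proof (rng B Q Py) as Sy.
  (* In the sum of the directions of [AP] and [BQ] the points [P], [Q] stand against [A], [B]; in
     their difference [P], [B] stand against [A], [Q]. Each arrangement yields one of the two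
     bounds. *)
  pose proof (fun s t al be => four_point_cauchy_schwarz K rho P Q A B s t al be HK HR) as CS1.
  pose proof (fun s t al be => four_point_cauchy_schwarz K rho A Q P B s t al be HK HR) as CS2.
  rewrite (Hs B P) in CS1. rewrite (Hs B A), (Hs P A) in CS2.
  pose proof (ck_sk_sq K (rho A P)) as Ex. pose proof (ck_sk_sq K (rho B Q)) as Ey.
  (* Here the diameter bound enters: nonnegative cosines make the weights chosen for [K > 0]
     nonnegative. *)
  assert (Nonneg : 0 < K -> forall X Y, (X = A \/ X = P \/ X = B \/ X = Q) ->
     (Y = A \/ Y = P \/ Y = B \/ Y = Q) -> 0 <= ck K (rho X Y)).
  { intros HK' X Y HX HY. specialize (Hdiam HK' X Y HX HY). pose proof (kappa_pos K HK) as Hk.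
    assert (E : sqrt K = kappa K) by (unfold kappa; rewrite Rabs_right; lra).
    rewrite E in Hdiam. apply Rle_div_r in Hdiam; [|lra].
    unfold ck; destruct (Rlt_dec 0 K); [|contradiction]. specialize (H0 X Y).
    apply cos_ge_0; nra. }
  assert (Ge1 : ~ 0 < K -> forall X Y, 1 <= ck K (rho X Y)).
  { intros HK' X Y. apply ck_ge_1; auto. lra. }
  rewrite cosq_ck.
  set (cx := ck K (rho A P)) in *. set (cy := ck K (rho B Q)) in *.
  set (ca := ck K (rho A B)) in *. set (cb := ck K (rho P Q)) in *.
  set (cd := ck K (rho P B)) in *. set (cf := ck K (rho A Q)) in *.
  set (sx := sk K (rho A P)) in *. set (sy := sk K (rho B Q)) in *.
  assert (Pxy : 0 < sx * sy) by now apply Rmult_lt_0_compat.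
  assert (Bounds : 0 <= ca /\
    (1 + ca) * (cb + cx * cy - sx * sy) <= (cx + cd) * (cy + cf) <=
    (1 + ca) * (cb + cx * cy + sx * sy)).
  { unfold sgK in *. destruct (Rlt_dec 0 K) as [HK' | HK'].
    - pose proof (Nonneg HK' A P ltac:(auto) ltac:(auto)) as Cx. fold cx in Cx.
      pose proof (Nonneg HK' B Q ltac:(auto) ltac:(auto)) as Cy. fold cy in Cy.
      pose proof (Nonneg HK' A B ltac:(auto) ltac:(auto)) as Ca. fold ca in Ca.
      pose proof (Nonneg HK' P Q ltac:(auto) ltac:(auto)) as Cb. fold cb in Cb.
      pose proof (Nonneg HK' P B ltac:(auto) ltac:(auto)) as Cd. fold cd in Cd.
      pose proof (Nonneg HK' A Q ltac:(auto) ltac:(auto)) as Cf. fold cf in Cf.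
      split; [assumption|]. split.
      + apply spherical_upper; auto; try lra. intros s t al be h1 h2 h3 h4.
        specialize (CS2 s t al be h1 h2 h3 h4).
        eapply Rle_trans; [|apply sqrt_mult_le_half_sum; apply weighted_norm_ge_0; assumption].
        fold cf cd. lra.
      + apply spherical_lower; auto; try lra. intros s t al be h1 h2 h3 h4.
        specialize (CS1 s t al be h1 h2 h3 h4). lra.
    - pose proof (Ge1 HK' A P) as Cx. pose proof (Ge1 HK' B Q) as Cy.
      pose proof (Ge1 HK' A B) as Ca. pose proof (Ge1 HK' P Q) as Cb.
      pose proof (Ge1 HK' P B) as Cd. pose proof (Ge1 HK' A Q) as Cf.
      fold cx in Cx. fold cy in Cy. fold ca in Ca. fold cb in Cb. fold cd in Cd. fold cf in Cf.
      split; [lra|]. split.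
      + apply hyperbolic_lower; auto; try lra. intros s t al be h1 h2 h3 h4.
        specialize (CS1 s t al be h1 h2 h3 h4). lra.
      + apply hyperbolic_upper; auto; try lra. intros s t al be h1 h2 h3 h4.
        specialize (CS2 s t al be h1 h2 h3 h4). lra. }
  destruct Bounds as (Pa & L & U).
  set (V := (1 + ca) * (cb + cx * cy) - (cx + cd) * (cy + cf)).
  assert (Pc : 0 < (1 + ca) * (sx * sy)) by (apply Rmult_lt_0_compat; lra).
  replace (sgK K * _) with (sgK K * (V / ((1 + ca) * (sx * sy))))
    by (unfold V; field; lra).
  assert (HV : -1 <= V / ((1 + ca) * (sx * sy)) <= 1).
  { split; [apply Rle_div_r | apply Rle_div_l]; unfold V; lra. }
  apply Rabs_le. unfold sgK. destruct (Rlt_dec 0 K); lra.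
Qed.
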